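(* For every nondeterministic protocol $\Pi=(\mathcal R,t)$ on domain $D=\{0,1\}^{n_1}\times\{0,1\}^{n_2}$ and every $(x,y)\in D$, $$I(x:y\mid \Pi) \ \ge\ I(x:y\mid t_{x,y},\Pi) - \log \rho(t_{x,y}) - O(\log n),$$ where $t_{x,y}=t(x,y)$, $n=\max(n_1,n_2)$, and the constant in $O(\log n)$ depends only on the universal machine.
   Context: Fix a universal Turing machine $U$. $C(x\mid u)$ is the length of a shortest $p$ with $U(p,u)=x$; tuples and finite objects are encoded as strings by fixed computable encodings. $I(x:y\mid u)=C(x\mid u)+C(y\mid u)-C(x,y\mid u)$. A rectangle in $D$ is a set of the form $S\times T$ with $S\subseteq\{0,1\}^{n_1}$, $T\subseteq\{0,1\}^{n_2}$. A (nondeterministic) protocol $\Pi=(\mathcal R,t)$ consists of a finite set $\mathcal R$ of rectangles whose union contains $D$, and a function $t$ assigning to each $(x,y)\in D$ a rectangle $t(x,y)\in\mathcal R$ containing $(x,y)$. $\Pi$ is regarded as a finite object (listing $\mathcal R$ and the table of $t$), and the rectangle $t(x,y)$ is identified with a string encoding its index in $\mathcal R$. The thickness $\rho_{x,y}$ of a cell $(x,y)$ is the number of rectangles of $\mathcal R$ containing $(x,y)$; the thickness of a rectangle $R$ is $\rho(R)=\max_{(x,y)\in R}\rho_{x,y}$. *)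

(* Defs.v *)
From HB Require Import structures.
From mathcomp Require Import all_boot all_order all_algebra.
From mathcomp Require Import boolp reals exp.

Set Implicit Arguments.
Unset Strict Implicit.
Unset Printing Implicit Defensive.

Notation bits := (seq bool).

Variant move := MoveLeft | Stay | MoveRight.

(* Deterministic machines with [k.+3] two-way infinite tapes: tape 0 holds the
   program, tape 1 the condition, tape 2 the output, the others are work tapes.
   Tape symbols are [option letter], [None] being the blank; bits are written
   through [letter_of_bit]. *)
Record TM := MkTM {
  work_tapes : nat;
  state : finType;
  letter : finType;
  letter_of_bit : bool -> letter;
  letter_of_bit_inj : injective letter_of_bit;
  start : state;
  halting : pred state;
  delta : state -> {ffun 'I_work_tapes.+3 -> option letter} ->
          state * {ffun 'I_work_tapes.+3 -> option letter * move} }.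

(* [Tape l a r] has head on [a], the cells to its left are [l] (nearest first)
   and those to its right are [r]; all the other cells are blank. *)
Record tape (A : Type) := Tape {
  tleft : seq (option A);
  tcur : option A;
  tright : seq (option A) }.

Definition tape_move (A : Type) (m : move) (t : tape A) : tape A :=
  match m with
  | MoveLeft => Tape (behead (tleft t)) (head None (tleft t)) (tcur t :: tright t)
  | Stay => t
  | MoveRight => Tape (tcur t :: tleft t) (head None (tright t)) (behead (tright t))
  end.

Definition tape_write (A : Type) (a : option A) (t : tape A) : tape A :=
  Tape (tleft t) a (tright t).

Record config (M : TM) := Config {
  cstate : state M;
  ctapes : 'I_(work_tapes M).+3 -> tape (letter M) }.

Definition step (M : TM) (c : config M) : config M :=
  if halting (cstate c) then c else
  let: (q, a) := delta (cstate c) [ffun i => tcur (ctapes c i)] in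
  Config q (fun i => tape_move (a i).2 (tape_write (a i).1 (ctapes c i))).

Definition input_tape (M : TM) (w : bits) : tape (letter M) :=
  let s := [seq Some (letter_of_bit M b) | b <- w] in
  Tape [::] (head None s) (behead s).

Definition init (M : TM) (p u : bits) : config M :=
  Config (start M) (fun i =>
    if val i == 0 then input_tape M p
    else if val i == 1 then input_tape M u
    else input_tape M [::]).

Fixpoint read_bits (M : TM) (s : seq (option (letter M))) : bits :=
  if s is Some a :: s' then
    if a == letter_of_bit M true then true :: read_bits s'
    else if a == letter_of_bit M false then false :: read_bits s'
    else [::]
  else [::].

(* The output is the longest word of bits starting at the head of tape 2. *)
Definition output (M : TM) (c : config M) : bits :=
  let t := ctapes c (inord 2) in read_bits (tcur t :: tright t).

(* [M(p, u) = x] *)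
Definition computes (M : TM) (p u x : bits) : Prop :=
  exists m, let c := iter m (@step M) (init M p u) in
    halting (cstate c) /\ output c = x.

(* Each program of each machine [V] translates, with additive overhead depending
   on [V] only, to a program of [U] with the same behaviour; this covers in
   particular the usual [U(w_V ++ p, u) = V(p, u)]. *)
Definition universal (U : TM) : Prop :=
  forall V : TM, exists c : nat, forall p : bits, exists q : bits,
    size q <= size p + c /\
    forall u x : bits, computes U q u x <-> computes V p u x.

(* The value 0 in the absence of any description is never used when [U] is
   universal. *)
Definition complexity (U : TM) (x u : bits) : nat :=
  if pselect (exists k, `[< exists p, size p = k /\ computes U p u x >])
    is left e then ex_minn e else 0.

Definition pair_code (x y : bits) : bits :=
  nseq (size x) true ++ false :: x ++ y.

Definition list_code (s : seq bits) : bits := foldr pair_code [::] s.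

(* Binary expansion, least significant bit first; 0 is the empty word. *)
Definition nat_code (m : nat) : bits :=
  mkseq (fun i => odd (m %/ 2 ^ i)) (up_log 2 m.+1).

Definition mutual_info (U : TM) (x y u : bits) : int :=
  ((complexity U x u)%:Z + (complexity U y u)%:Z
   - (complexity U (pair_code x y) u)%:Z)%R.

Notation cell n1 n2 := (n1.-tuple bool * n2.-tuple bool)%type.

Definition is_rectangle (n1 n2 : nat) (A : {set cell n1 n2}) : Prop :=
  exists (S : {set n1.-tuple bool}) (T : {set n2.-tuple bool}), A = setX S T.

Record protocol (n1 n2 : nat) := Protocol {
  rects : {set {set cell n1 n2}};
  sel : cell n1 n2 -> {set cell n1 n2};
  rectsP : forall A, A \in rects -> is_rectangle A;
  rects_cover : [set: cell n1 n2] \subset cover rects;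
  sel_rects : forall z, sel z \in rects;
  sel_mem : forall z, z \in sel z }.

Definition cell_thickness (n1 n2 : nat) (P : protocol n1 n2)
    (z : cell n1 n2) : nat :=
  #|[set A in rects P | z \in A]|.

Definition thickness (n1 n2 : nat) (P : protocol n1 n2)
    (A : {set cell n1 n2}) : nat :=
  \max_(z in A) cell_thickness P z.

(* Rectangles are listed in the order of [enum (rects P)]; [rect_index_code]
   encodes the position of a rectangle in this list. *)
Definition rect_index_code (n1 n2 : nat) (P : protocol n1 n2)
    (A : {set cell n1 n2}) : bits :=
  nat_code (index A (enum (rects P))).

Definition cell_code (n1 n2 : nat) (z : cell n1 n2) : bits :=
  pair_code z.1 z.2.

Definition rect_code (n1 n2 : nat) (A : {set cell n1 n2}) : bits :=
  list_code [seq cell_code z | z <- enum A].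

Definition protocol_code (n1 n2 : nat) (P : protocol n1 n2) : bits :=
  pair_code
    (list_code [seq rect_code A | A <- enum (rects P)])
    (list_code [seq pair_code (cell_code z) (rect_index_code P (sel P z))
               | z <- enum {: cell n1 n2}]).

Definition log2 (R : realType) (x : R) : R := (ln x / ln 2)%R.

(* Main.v *)
Require Import Defs.
From HB Require Import structures.
From mathcomp Require Import all_boot all_order all_algebra.
From mathcomp Require Import boolp reals exp.
From mathcomp Require Import zify lra.

(** Write [a = C(x | P)], [b = C(y | P)] and let [t = S x T] be the rectangle of
    [(x, y)]. Let [X] and [Y] be the sets of strings of complexity at most [a]
    and [b] given [P]; they are enumerable and have at most [2^(a+1)] and
    [2^(b+1)] elements. Enumerating [S :&: X] shows that
    [C(x | t, P) <= log #|S :&: X| + O(log n)], and similarly for [y]. Every cell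
    of [t] has thickness at most [rho], so counting incidences bounds by
    [rho * #|X| * #|Y| / 2^i] the number of rectangles that have at least
    [2^i] cells of thickness at most [rho] in [X x Y]. With
    [i ~ log #|S :&: X| + log #|T :&: Y|], enumerating these rectangles locates
    [t], hence
    [C(x, y | P) <= C(x, y | t, P) + a + b + log rho - i + O(log n)],
    and adding up gives the inequality. No symmetry of information is used.

    The enumerations are programs of a small language on binary trees, which is
    compiled to multitape Turing machines; such a program simulates [U] on trees. *)

Set Implicit Arguments.
Unset Strict Implicit.
Unset Printing Implicit Defensive.

(** * Structured programs on stacks *)

(** The sets [X] and [Y] can be enumerated but not decided, and the complexities that define them
    are not computable. Hence a description carries the numbers [a], [b], [i], [r] along with a
    position in an enumeration without repetition, and a bound on the number of enumerated objects
    serves only to bound the length of that position. The numbers are linear in [n] and cost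
    [O(log n)] bits, except that [r] may be huge; but then the inequality is trivial.

    Only [t] is known to consist of cells of thickness at most [rho]; the other rectangles may
    contain thicker ones. Counting thin cells alone makes the incidence bound apply to all
    rectangles at once. That [t] is a rectangle enters through
    [t :&: (X x Y) = (S :&: X) x (T :&: Y)]: for this reason the logarithms of the two sides add up
    to [i].

    Universality speaks of Turing machines only, so each enumeration has to be realised by a
    machine. Since machines are built only to bound complexities from above, they need the right
    output on the intended inputs and nothing else; running time is irrelevant. *)

Notation tapes := ('I_7 -> tape bool).
Notation tops := {ffun 'I_7 -> option bool}.
Notation action := {ffun 'I_7 -> option bool * move}.

(* A piece of machine with one entry and one exit, the latter being [None]. *)
Record block := Block {
  bstate : finType;
  bentry : bstate;
  bdelta : bstate -> tops -> option bstate * action }.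

Definition act (a : action) (T : tapes) : tapes :=
  fun i => tape_move (a i).2 (tape_write (a i).1 (T i)).

Definition tops_of (T : tapes) : tops := [ffun i => tcur (T i)].

Inductive bsteps (B : block) : bstate B -> tapes -> tapes -> Prop :=
| bsteps_exit q T a : bdelta q (tops_of T) = (None, a) -> bsteps q T (act a T)
| bsteps_next q T q' a T' : bdelta q (tops_of T) = (Some q', a) ->
    bsteps q' (act a T) T' -> bsteps q T T'.

(* The head of a tape stands on the top of the stack; cells left of the head
   are irrelevant. *)
Definition tape_stack (t : tape bool) (s : bits) : Prop :=
  exists m, tcur t :: tright t = map Some s ++ nseq m None.

Definition stacks (T : tapes) (s : seq bits) : Prop :=
  forall i, tape_stack (T i) (nth [::] s i).

Variant runs (B : block) (s s' : seq bits) : Prop :=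
  Runs of forall T, stacks T s ->
    exists2 T', bsteps (bentry B) T T' & stacks T' s'.

Definition keep (h : tops) : action := [ffun i => (h i, Stay)].

Definition on_tape (i : 'I_7) (w : option bool) (m : move) (h : tops) : action :=
  [ffun j => if j == i then (w, m) else (h j, Stay)].

(** A machine step writes before it moves, so a push takes two steps: move left, then overwrite
    whatever is found there. A pop only moves right and leaves garbage to the left of the head,
    which [tape_stack] ignores. *)
Definition push_block (i : 'I_7) (a : bool) : block :=
  @Block bool false (fun q h =>
    if q then (None, on_tape i (Some a) Stay h)
    else (Some true, on_tape i (h i) MoveLeft h)).

Definition pop_block (i : 'I_7) : block :=
  @Block unit tt (fun _ h => (None, on_tape i (h i) MoveRight h)).

Definition seq_block (B1 B2 : block) : block :=
  @Block (bstate B1 + bstate B2)%type (inl (bentry B1)) (fun q h =>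
    match q with
    | inl q1 => let: (r, a) := bdelta q1 h in
                (Some (if r is Some q' then inl q' else inr (bentry B2)), a)
    | inr q2 => let: (r, a) := bdelta q2 h in (omap inr r, a)
    end).

Definition if_block (i : 'I_7) (P : pred (option bool)) (B1 B2 : block) : block :=
  @Block (option (bstate B1 + bstate B2)) None (fun q h =>
    match q with
    | None => (Some (Some (if P (h i) then inl (bentry B1) else inr (bentry B2))),
               keep h)
    | Some (inl q1) => let: (r, a) := bdelta q1 h in (omap (Some \o inl) r, a)
    | Some (inr q2) => let: (r, a) := bdelta q2 h in (omap (Some \o inr) r, a)
    end).

(** The state [None] performs the test. As it is also the exit of the body, leaving the body returns
    to the test. *)
Definition while_block (i : 'I_7) (P : pred (option bool)) (B : block) : block :=
  @Block (option (bstate B)) None (fun q h =>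
    match q with
    | None => (if P (h i) then Some (Some (bentry B)) else None, keep h)
    | Some q' => let: (r, a) := bdelta q' h in (Some r, a)
    end).

Lemma tape_stack_cur t s : tape_stack t s -> tcur t = ohead s.
Proof. by case: s => [|a s] [[|m]] //= []. Qed.

Lemma tops_ofE T s i : stacks T s -> tops_of T i = ohead (nth [::] s i).
Proof. by move=> Ts; rewrite ffunE; apply: tape_stack_cur. Qed.

Lemma act_keep T : act (keep (tops_of T)) T =1 T.
Proof. by move=> i; rewrite /act !ffunE /=; case: (T i). Qed.

Lemma stacks_keep T s : stacks T s -> stacks (act (keep (tops_of T)) T) s.
Proof. by move=> Ts i; rewrite act_keep. Qed.

Lemma runs_push i a s :
  runs (push_block i a) s (set_nth [::] s i (a :: nth [::] s i)).
Proof.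
split=> T Ts; eexists.
  by apply: (@bsteps_next (push_block i a)); [|apply: bsteps_exit].
move=> j; rewrite nth_set_nth /= /act !ffunE val_eqE.
case: eqVneq => [->|_] /=; last by case: (T j) (Ts j).
by have [m E] := Ts i; exists m; rewrite /= E.
Qed.

Lemma runs_pop i s :
  runs (pop_block i) s (set_nth [::] s i (behead (nth [::] s i))).
Proof.
split=> T Ts; eexists; first exact: bsteps_exit.
move=> j; rewrite nth_set_nth /= /act !ffunE val_eqE.
case: eqVneq => [->|_] /=; last by case: (T j) (Ts j).
case: (Ts i) => m; case: (T i) => l c r /=.
case: (nth _ _ _) => [|a s'] /=; case: r => [|d r] /=.
- by exists 1.
- by case: m => // m [_ E]; exists m.
- by case: s' => [|? ?] //= [_ E]; exists 1.
by case=> _ E; exists m.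
Qed.

Lemma bsteps_trans B1 B2 q T T1 T2 :
  @bsteps B1 q T T1 -> bsteps (bentry B2) T1 T2 ->
  @bsteps (seq_block B1 B2) (inl q) T T2.
Proof.
move=> H1 H2; elim: H1 H2 => {q T T1} [q T a E|q T q' a T' E _ IH] H2.
  apply: (@bsteps_next (seq_block B1 B2)); first by rewrite /= E.
  elim: H2 => {T q a E T2} [q T a E|q T q' a T' E _ IH].
    by apply: bsteps_exit; rewrite /= E.
  by apply: (@bsteps_next (seq_block B1 B2)) IH; rewrite /= E.
by apply: (@bsteps_next (seq_block B1 B2)) (IH H2); rewrite /= E.
Qed.

Lemma runs_seq B1 B2 s s1 s2 :
  runs B1 s s1 -> runs B2 s1 s2 -> runs (seq_block B1 B2) s s2.
Proof.
case=> H1 [H2]; split=> T /H1[T1 S1 /H2[T2 S2 R2]]; exists T2 => //.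
exact: bsteps_trans S1 S2.
Qed.

Lemma runs_if (i : 'I_7) (P : pred (option bool)) B1 B2 s s' :
  runs (if P (ohead (nth [::] s i)) then B1 else B2) s s' ->
  runs (if_block i P B1 B2) s s'.
Proof.
case=> H; split=> T Ts; have [T' S' R'] := H _ (stacks_keep Ts); exists T' => //=.
apply: (@bsteps_next (if_block i P B1 B2)); first by rewrite /= (tops_ofE _ Ts).
move: S'; move: (act _ T) => T1; case: (P _) => {H}.
- elim=> {T Ts T1 T' R'} [q T a E|q T q' a T' E _ IH].
    by apply: bsteps_exit; rewrite /= E.
  by apply: (@bsteps_next (if_block i P B1 B2)) IH; rewrite /= E.
elim=> {T Ts T1 T' R'} [q T a E|q T q' a T' E _ IH].
  by apply: bsteps_exit; rewrite /= E.
by apply: (@bsteps_next (if_block i P B1 B2)) IH; rewrite /= E.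
Qed.

Lemma runs_ifT (i : 'I_7) (P : pred (option bool)) B1 B2 s s' :
  P (ohead (nth [::] s i)) -> runs B1 s s' -> runs (if_block i P B1 B2) s s'.
Proof. by move=> Pi H; apply: runs_if; rewrite Pi. Qed.

Lemma runs_ifF (i : 'I_7) (P : pred (option bool)) B1 B2 s s' :
  ~~ P (ohead (nth [::] s i)) -> runs B2 s s' -> runs (if_block i P B1 B2) s s'.
Proof. by move=> /negPf Pi H; apply: runs_if; rewrite Pi. Qed.

Lemma runs_while_end (i : 'I_7) (P : pred (option bool)) B s :
  ~~ P (ohead (nth [::] s i)) -> runs (while_block i P B) s s.
Proof.
move=> nP; split=> T Ts; eexists; last exact: (stacks_keep Ts).
by apply: bsteps_exit; rewrite /= (tops_ofE _ Ts) (negPf nP).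
Qed.

Lemma runs_while (i : 'I_7) (P : pred (option bool)) B s s1 s2 :
  P (ohead (nth [::] s i)) -> runs B s s1 ->
  runs (while_block i P B) s1 s2 -> runs (while_block i P B) s s2.
Proof.
move=> Pi [H1] [H2]; split=> T Ts; have [T1 S1 /H2[T2 S2 R2]] := H1 _ (stacks_keep Ts).
exists T2 => //; apply: (@bsteps_next (while_block i P B)).
  by rewrite /= (tops_ofE _ Ts) Pi.
elim: S1 S2 => {T Ts T1} [q T a E|q T q' a T' E _ IH] S2.
  by apply: (@bsteps_next (while_block i P B)) S2; rewrite /= E.
by apply: (@bsteps_next (while_block i P B)) (IH S2); rewrite /= E.
Qed.

Definition block_delta (B : block) (q : option (bstate B)) (h : tops) :
    option (bstate B) * action :=
  if q is Some q' then bdelta q' h else (None, keep h).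

Definition block_machine (B : block) : TM :=
  @MkTM 4 (option (bstate B)) bool id (fun _ _ => id) (Some (bentry B))
    (fun q => q == None) (@block_delta B).

Lemma bsteps_iter B q T T' : @bsteps B q T T' ->
  exists m, iter m (@step (block_machine B)) (@Config (block_machine B) (Some q) T)
    = @Config (block_machine B) None T'.
Proof.
elim=> {q T T'} [q T a E|q T q' a T' E _ [m <-]].
  by exists 1; rewrite /= /step /= -/(tops_of T) E.
by exists m.+1; rewrite iterSr /step /= -/(tops_of T) E.
Qed.

Lemma computes_block B p u x s :
  runs B [:: p; u] s -> nth [::] s 2 = x -> computes (block_machine B) p u x.
Proof.
case=> H s2; have [|T' S' R'] := H (ctapes (init (block_machine B) p u)).
  move=> i; rewrite /init /=.
  have E w : tape_stack (input_tape (block_machine B) w) w.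
    by case: w => [|a w]; [exists 1 | exists 0; rewrite /= cats0].
  case: eqVneq => [->|i0] //=; case: eqVneq => [->|i1] //=.
  by rewrite nth_default //=; case: i i0 i1 => [[|[|?]]].
have [m E] := bsteps_iter S'; exists m => /=.
rewrite -/(init (block_machine B) p u) in E *; rewrite E; split=> //.
have [k Ek] := R' (inord 2).
transitivity (@read_bits (block_machine B)
  (tcur (T' (inord 2)) :: tright (T' (inord 2)))) => //.
rewrite Ek.
rewrite inordK // s2; elim: x {s2 Ek} => [|a x IH] /=; first by case: k.
by case: a; rewrite IH.
Qed.
(** * A programming language on binary trees *)

Inductive tree := Leaf | Node of tree & tree.

Inductive code :=
| Id | Comp of code & code | Nil | Pair of code & code | Hd | Tl
| Cond of code & code | Loop of code.

(* [Leaf] stands for false; [Cond] and [Loop] branch on the left subtree and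
   pass the right one. *)
Inductive ev : code -> tree -> tree -> Prop :=
| ev_id x : ev Id x x
| ev_comp f g x y z : ev f x y -> ev g y z -> ev (Comp g f) x z
| ev_nil x : ev Nil x Leaf
| ev_pair f g x y z : ev f x y -> ev g x z -> ev (Pair f g) x (Node y z)
| ev_hd x y : ev Hd (Node x y) x
| ev_tl x y : ev Tl (Node x y) y
| ev_cond_true f g a b x y : ev f x y -> ev (Cond f g) (Node (Node a b) x) y
| ev_cond_false f g x y : ev g x y -> ev (Cond f g) (Node Leaf x) y
| ev_loop_end f x : ev (Loop f) (Node Leaf x) x
| ev_loop f a b x y z : ev f x y -> ev (Loop f) y z ->
    ev (Loop f) (Node (Node a b) x) z.

(** Prefix notation is self-delimiting: a tree can be read off the top of a stack whatever lies
    below it, so several values can share a tape. *)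
Fixpoint polish (t : tree) : bits :=
  if t is Node l r then true :: polish l ++ polish r else [:: false].

(* The inputs are on [tP] and [tC], the output on [tO]. The current value is
   the top tree of [tM] and saved values are on [tE], all in Polish notation;
   [tA] is a buffer and [tB] a unary counter. *)
Definition tP : 'I_7 := @Ordinal 7 0 isT.
Definition tC : 'I_7 := @Ordinal 7 1 isT.
Definition tO : 'I_7 := @Ordinal 7 2 isT.
Definition tM : 'I_7 := @Ordinal 7 3 isT.
Definition tA : 'I_7 := @Ordinal 7 4 isT.
Definition tB : 'I_7 := @Ordinal 7 5 isT.
Definition tE : 'I_7 := @Ordinal 7 6 isT.

Declare Scope block_scope.
Delimit Scope block_scope with blk.
Notation "B1 ;; B2" := (seq_block B1 B2)
  (at level 100, right associativity) : block_scope.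
Local Open Scope block_scope.

Definition top1 : pred (option bool) := pred1 (Some true).
Definition nonempty : pred (option bool) := isSome.

Definition transfer (i j : 'I_7) : block :=
  if_block i top1 (pop_block i ;; push_block j true)
                  (pop_block i ;; push_block j false).

Definition transfer2 (i j k : 'I_7) : block :=
  if_block i top1 (pop_block i ;; push_block j true ;; push_block k true)
                  (pop_block i ;; push_block j false ;; push_block k false).

(* [tB] counts the subtrees that remain to be read. *)
Definition drop_tree : block :=
  push_block tB true ;;
  while_block tB nonempty
    (if_block tM top1 (pop_block tM ;; push_block tB true)
                      (pop_block tM ;; pop_block tB)).

Definition lift_tree (i : 'I_7) : block :=
  push_block tB true ;;
  while_block tB nonempty
    (if_block i top1 (transfer i tA ;; push_block tB true)
                     (transfer i tA ;; pop_block tB)).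

Definition pour (i j : 'I_7) : block := while_block i nonempty (transfer i j).

Definition pour2 (i j k : 'I_7) : block :=
  while_block i nonempty (transfer2 i j k).

(** Between instructions [tA] and [tB] are empty, so pouring [tA] is a valid [Id]. In [Pair], the
    argument is saved on [tE] and [g] runs first, because the right subtree lies deeper on the stack
    than the left one. Lifting reverses a word and pouring reverses it back. *)
Fixpoint compile (f : code) : block :=
  match f with
  | Id => pour tA tM
  | Comp g f => compile f ;; compile g
  | Nil => drop_tree ;; push_block tM false
  | Pair f g => lift_tree tM ;; pour2 tA tM tE ;; compile g ;;
                lift_tree tE ;; pour tA tM ;; compile f ;; push_block tM true
  | Hd => pop_block tM ;; lift_tree tM ;; drop_tree ;; pour tA tM
  | Tl => pop_block tM ;; drop_tree
  | Cond f g => pop_block tM ;;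
                if_block tM top1 (drop_tree ;; compile f)
                                 (pop_block tM ;; compile g)
  | Loop f => pop_block tM ;;
              while_block tM top1 (drop_tree ;; compile f ;; pop_block tM) ;;
              pop_block tM
  end.

(** * Correctness of the compilation *)

Section Runs.
Variables p u o : bits.
Notation S m a b e := [:: p; u; o; m; a; b; e].

Lemma runs_transferMA c m a b e :
  runs (transfer tM tA) (S (c :: m) a b e) (S m (c :: a) b e).
Proof.
apply: runs_if; case: c => /=.
  exact: runs_seq (runs_pop _ _) (runs_push _ _ _).
exact: runs_seq (runs_pop _ _) (runs_push _ _ _).
Qed.

Lemma runs_transferEA c m a b e :
  runs (transfer tE tA) (S m a b (c :: e)) (S m (c :: a) b e).
Proof.
apply: runs_if; case: c => /=.
  exact: runs_seq (runs_pop _ _) (runs_push _ _ _).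
exact: runs_seq (runs_pop _ _) (runs_push _ _ _).
Qed.

Lemma runs_transferAM c m a b e :
  runs (transfer tA tM) (S m (c :: a) b e) (S (c :: m) a b e).
Proof.
apply: runs_if; case: c => /=.
  exact: runs_seq (runs_pop _ _) (runs_push _ _ _).
exact: runs_seq (runs_pop _ _) (runs_push _ _ _).
Qed.

Lemma runs_drop_tree x m a e :
  runs drop_tree (S (polish x ++ m) a [::] e) (S m a [::] e).
Proof.
apply: runs_seq (runs_push _ _ _) _ => /=.
set W := while_block _ _ _.
(* The induction needs an arbitrary counter: reading one tree uses up one unit of it, and the rest
   of the loop is left to the hypothesis. *)
have {}H b s : runs W (S m a b e) s -> runs W (S (polish x ++ m) a (true :: b) e) s.
  elim: x m b => [|l IHl r IHr] m b H /=.
    apply: runs_while H => //; apply: runs_if => /=.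
    exact: runs_seq (runs_pop _ _) (runs_pop _ _).
  apply: (@runs_while _ _ _ _ (S (polish l ++ polish r ++ m) a (true :: true :: b) e)).
  - by [].
  - apply: runs_if => /=; rewrite catA.
    exact: runs_seq (runs_pop _ _) (runs_push _ _ _).
  exact/IHl/IHr.
by apply: H; apply: runs_while_end.
Qed.

Lemma runs_lift_treeM x m a e :
  runs (lift_tree tM) (S (polish x ++ m) a [::] e)
    (S m (rev (polish x) ++ a) [::] e).
Proof.
apply: runs_seq (runs_push _ _ _) _ => /=.
set W := while_block _ _ _.
have {}H b s : runs W (S m (rev (polish x) ++ a) b e) s ->
    runs W (S (polish x ++ m) a (true :: b) e) s.
  elim: x m a b => [|l IHl r IHr] m a b H /=.
    apply: runs_while H => //; apply: runs_if => /=.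
    exact: runs_seq (runs_transferMA _ _ _ _ _) (runs_pop _ _).
  apply: (@runs_while _ _ _ _
    (S (polish l ++ polish r ++ m) (true :: a) (true :: true :: b) e)).
  - by [].
  - apply: runs_if => /=; rewrite catA.
    exact: runs_seq (runs_transferMA _ _ _ _ _) (runs_push _ _ _).
  apply/IHl/IHr; move: H.
  by rewrite /= rev_cons rev_cat -cats1 -!catA.
by apply: H; apply: runs_while_end.
Qed.

Lemma runs_lift_treeE x m a e :
  runs (lift_tree tE) (S m a [::] (polish x ++ e))
    (S m (rev (polish x) ++ a) [::] e).
Proof.
apply: runs_seq (runs_push _ _ _) _ => /=.
set W := while_block _ _ _.
have {}H b s : runs W (S m (rev (polish x) ++ a) b e) s ->
    runs W (S m a (true :: b) (polish x ++ e)) s.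
  elim: x e a b => [|l IHl r IHr] e a b H /=.
    apply: runs_while H => //; apply: runs_if => /=.
    exact: runs_seq (runs_transferEA _ _ _ _ _) (runs_pop _ _).
  apply: (@runs_while _ _ _ _
    (S m (true :: a) (true :: true :: b) (polish l ++ polish r ++ e))).
  - by [].
  - apply: runs_if => /=; rewrite catA.
    exact: runs_seq (runs_transferEA _ _ _ _ _) (runs_push _ _ _).
  apply/IHl/IHr; move: H.
  by rewrite /= rev_cons rev_cat -cats1 -!catA.
by apply: H; apply: runs_while_end.
Qed.

Lemma runs_pourAM w m b e :
  runs (pour tA tM) (S m w b e) (S (catrev w m) [::] b e).
Proof.
elim: w m => [|c w IH] m; first exact: runs_while_end.
exact: runs_while (runs_transferAM _ _ _ _ _) (IH _).
Qed.

Lemma runs_pour2AME w m b e :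
  runs (pour2 tA tM tE) (S m w b e) (S (catrev w m) [::] b (catrev w e)).
Proof.
elim: w m e => [|c w IH] m e; first exact: runs_while_end.
apply: runs_while (IH _ _) => //; apply: runs_if; case: c => /=.
  exact: runs_seq (runs_pop _ _) (runs_seq (runs_push _ _ _) (runs_push _ _ _)).
exact: runs_seq (runs_pop _ _) (runs_seq (runs_push _ _ _) (runs_push _ _ _)).
Qed.

(** Induction on the number of iterations, with the code kept equal to [Loop f] throughout. *)
Lemma ev_loop_inv f x z (E : tree -> tree -> Prop) :
  (forall x, E (Node Leaf x) x) ->
  (forall a b x y z, ev f x y -> E y z -> E (Node (Node a b) x) z) ->
  ev (Loop f) x z -> E x z.
Proof.
move=> H0 H1 H; move Dg : (Loop f) H => g H.
elim: H Dg => // {g x z} g a b x y z Hf _ _ IH [Dg].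
by apply: (H1 _ _ _ y); [rewrite Dg | apply: IH; rewrite Dg].
Qed.

Lemma runs_compile f x y : ev f x y -> forall m e,
  runs (compile f) (S (polish x ++ m) [::] [::] e) (S (polish y ++ m) [::] [::] e).
Proof.
have rcat w m : catrev (rev w ++ [::]) m = w ++ m by rewrite cats0 catrevE revK.
elim: f x y => [|g IHg f IHf||f IHf g IHg|||f IHf g IHg|f IHf] x y H m e /=.
- by inversion_clear H; apply: runs_pourAM.
- by inversion_clear H; apply: runs_seq (IHf _ _ _ _ _) (IHg _ _ _ _ _); eassumption.
- inversion_clear H.
  exact: runs_seq (runs_drop_tree _ _ _ _) (runs_push _ _ _).
- inversion_clear H.
  apply: runs_seq (runs_lift_treeM _ _ _ _) _.
  apply: runs_seq (runs_pour2AME _ _ _ _) _; rewrite !rcat.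
  apply: runs_seq (IHg _ _ _ _ _) _; first by eassumption.
  apply: runs_seq (runs_lift_treeE _ _ _ _) _.
  apply: runs_seq (runs_pourAM _ _ _ _) _; rewrite !rcat /= -catA.
  by apply: runs_seq (IHf _ _ _ _ _) (runs_push _ _ _).
- inversion_clear H; apply: runs_seq (runs_pop _ _) _; rewrite /= -catA.
  apply: runs_seq (runs_lift_treeM _ _ _ _) _.
  apply: runs_seq (runs_drop_tree _ _ _ _) _.
  by rewrite -[polish y ++ m]rcat; apply: runs_pourAM.
- inversion_clear H; apply: runs_seq (runs_pop _ _) _; rewrite /= -catA.
  exact: runs_drop_tree.
- inversion_clear H; apply: runs_seq (runs_pop _ _) _; rewrite /= -?catA.
    apply: runs_ifT => //; apply: runs_seq _ (IHf _ _ _ _ _).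
      by rewrite catA; apply: (runs_drop_tree (Node a b)).
    by eassumption.
  by apply: runs_ifF => //; apply: runs_seq (runs_pop _ _) _; apply: IHg.
(* Loop invariant: the root mark of the current value has been popped, so the symbol tested is the
   root of its left subtree [c]. On leaving, this subtree is the single [false] above the result. *)
have {H} [c [x' [-> H]]]: exists c x', x = Node c x' /\
    runs (while_block tM top1 (drop_tree ;; compile f ;; pop_block tM))
      (S (polish c ++ polish x' ++ m) [::] [::] e)
      (S (false :: polish y ++ m) [::] [::] e).
  pattern x, y; apply: (ev_loop_inv _ _ H) => {x y H} [x|a b x y z Hf [c [x' [Ey H]]]].
    by exists Leaf, x; split=> //; apply: runs_while_end.
  exists (Node a b), x; split=> //.
  apply: runs_while H => //; apply: runs_seq (runs_drop_tree _ _ _ _) _.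
  apply: runs_seq (IHf _ _ _ _ _) _; first by eassumption.
  by rewrite Ey /= -catA; apply: runs_pop.
apply: runs_seq (runs_pop _ _) _; rewrite /= -catA.
by apply: runs_seq H (runs_pop _ _).
Qed.
End Runs.

(** * Input and output of compiled programs *)

Definition bit_tree (b : bool) : tree := if b then Node Leaf Leaf else Leaf.

(** Convertible with the encoding [enc] of [seq bool] introduced below, so that statements on
    [computable] apply directly to machine inputs. *)
Definition bits_tree (w : bits) : tree :=
  foldr (fun b => Node (bit_tree b)) Leaf w.

Definition load (i : 'I_7) : block :=
  pour i tA ;; push_block tM false ;;
  while_block tA nonempty
    (if_block tA top1
       (pop_block tA ;; push_block tM false ;; push_block tM false ;;
        push_block tM true ;; push_block tM true)
       (pop_block tA ;; push_block tM false ;; push_block tM true)).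

Definition unload : block :=
  while_block tM top1
    (pop_block tM ;;
     if_block tM top1
       (pop_block tM ;; pop_block tM ;; pop_block tM ;; push_block tA true)
       (pop_block tM ;; push_block tA false)) ;;
  pour tA tO.

(** The condition is loaded first, so the program ends up above it and one more [true] turns the two
    into the pair that [f] expects. *)
Definition code_machine (f : code) : TM :=
  block_machine
    (load tC ;; load tP ;; push_block tM true ;; compile f ;; unload).

Lemma runs_load_loop p u o w v m e :
  runs (push_block tM false ;;
    while_block tA nonempty
    (if_block tA top1
       (pop_block tA ;; push_block tM false ;; push_block tM false ;;
        push_block tM true ;; push_block tM true)
       (pop_block tA ;; push_block tM false ;; push_block tM true)))
    [:: p; u; o; m; catrev w v; [::]; e]
    [:: p; u; o; polish (bits_tree (catrev v w)) ++ m; [::]; [::]; e].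
Proof.
apply: runs_seq (runs_push _ _ _) _ => /=.
set W := while_block _ _ _.
have H s t : runs W [:: p; u; o; polish (bits_tree t) ++ m; s; [::]; e]
      [:: p; u; o; polish (bits_tree (catrev s t)) ++ m; [::]; [::]; e].
  elim: s t => [|b s IH] t; first exact: runs_while_end.
  apply: runs_while (IH (b :: t)) => //; case: b; last first.
    apply: runs_ifF => //; apply: runs_seq (runs_pop _ _) _.
    exact: runs_seq (runs_push _ _ _) (runs_push _ _ _).
  apply: runs_ifT => //; apply: runs_seq (runs_pop _ _) _.
  by do 3 apply: runs_seq (runs_push _ _ _) _; apply: runs_push.
by have := H (catrev w v) [::]; rewrite !catrevE cats0 rev_cat revK.
Qed.

Lemma runs_loadC p u m e :
  runs (load tC) [:: p; u; [::]; m; [::]; [::]; e]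
    [:: p; [::]; [::]; polish (bits_tree u) ++ m; [::]; [::]; e].
Proof.
apply: runs_seq _ (runs_load_loop p [::] [::] u [::] m e).
have H a : runs (pour tC tA) [:: p; u; [::]; m; a; [::]; e]
    [:: p; [::]; [::]; m; catrev u a; [::]; e]; last exact: (H [::]).
elim: u a => [|c w IH] a; first exact: runs_while_end.
apply: runs_while (IH (c :: a)) => //; apply: runs_if; case: c => /=.
  exact: runs_seq (runs_pop _ _) (runs_push _ _ _).
exact: runs_seq (runs_pop _ _) (runs_push _ _ _).
Qed.

Lemma runs_loadP p m e :
  runs (load tP) [:: p; [::]; [::]; m; [::]; [::]; e]
    [:: [::]; [::]; [::]; polish (bits_tree p) ++ m; [::]; [::]; e].
Proof.
apply: runs_seq _ (runs_load_loop [::] [::] [::] p [::] m e).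
have H a : runs (pour tP tA) [:: p; [::]; [::]; m; a; [::]; e]
    [:: [::]; [::]; [::]; m; catrev p a; [::]; e]; last exact: (H [::]).
elim: p a => [|c w IH] a; first exact: runs_while_end.
apply: runs_while (IH (c :: a)) => //; apply: runs_if; case: c => /=.
  exact: runs_seq (runs_pop _ _) (runs_push _ _ _).
exact: runs_seq (runs_pop _ _) (runs_push _ _ _).
Qed.

Lemma runs_unload x m :
  exists m', runs unload
    [:: [::]; [::]; [::]; polish (bits_tree x) ++ m; [::]; [::]; [::]]
    [:: [::]; [::]; x; m'; [::]; [::]; [::]].
Proof.
exists (false :: m).
apply: (@runs_seq _ _ _
  [:: [::]; [::]; [::]; false :: m; catrev x [::]; [::]; [::]]).
  set W := while_block _ _ _.
  have H a : runs W
      [:: [::]; [::]; [::]; polish (bits_tree x) ++ m; a; [::]; [::]]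
      [:: [::]; [::]; [::]; false :: m; catrev x a; [::]; [::]]; last exact: (H [::]).
  elim: x a => [|b x IH] a; first exact: runs_while_end.
  apply: runs_while (IH (b :: a)) => //; apply: runs_seq (runs_pop _ _) _.
  case: b.
    apply: runs_ifT => //; do 3 apply: runs_seq (runs_pop _ _) _.
    exact: runs_push.
  by apply: runs_ifF => //; apply: runs_seq (runs_pop _ _) (runs_push _ _ _).
have H s t : runs (pour tA tO) [:: [::]; [::]; t; false :: m; s; [::]; [::]]
    [:: [::]; [::]; catrev s t; false :: m; [::]; [::]; [::]].
  elim: s t => [|c s IH] t; first exact: runs_while_end.
  apply: runs_while (IH (c :: t)) => //; apply: runs_if; case: c => /=.
    exact: runs_seq (runs_pop _ _) (runs_push _ _ _).
  exact: runs_seq (runs_pop _ _) (runs_push _ _ _).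
by have := H (catrev x [::]) [::]; rewrite !catrevE !cats0 revK.
Qed.

Lemma stacks_pad T s k : stacks T (s ++ nseq k [::]) <-> stacks T s.
Proof.
suff E i : nth [::] (s ++ nseq k [::]) i = nth [::] s i.
  by split=> H i; have := H i; rewrite E.
rewrite nth_cat; case: ltnP => // si.
by rewrite nth_nseq if_same nth_default.
Qed.

Lemma computes_code f p u x :
  ev f (Node (bits_tree p) (bits_tree u)) (bits_tree x) ->
  computes (code_machine f) p u x.
Proof.
move=> H; have [m' Hun] := runs_unload x [::].
apply: (@computes_block _ _ _ _ [:: [::]; [::]; x; m'; [::]; [::]; [::]]) => //.
set B := seq_block _ _.
suff [R] : runs B [:: p; u; [::]; [::]; [::]; [::]; [::]]
    [:: [::]; [::]; x; m'; [::]; [::]; [::]].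
  by split=> T /(stacks_pad _ _ 5)/R.
apply: runs_seq (runs_loadC _ _ _ _) _; apply: runs_seq (runs_loadP _ _ _) _.
apply: runs_seq (runs_push _ _ _) _; apply: runs_seq _ Hun.
have := runs_compile [::] [::] [::] H [::] [::].
by rewrite /= !catA !cats0.
Qed.

(** * Complexity bounds from codes *)

Lemma complexity_le U x u q : computes U q u x -> complexity U x u <= size q.
Proof.
move=> Uq; rewrite /complexity; case: pselect => // e.
by case: ex_minnP => m _; apply; apply/asboolP; exists q.
Qed.

Lemma complexityP U x u q : computes U q u x ->
  exists2 p, size p = complexity U x u & computes U p u x.
Proof.
move=> Uq; rewrite /complexity; case: pselect => [e|[]]; last first.
  by exists (size q); apply/asboolP; exists q.
by case: ex_minnP => m /asboolP[p [<- Up]] _; exists p.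
Qed.

Lemma complexity_code U f : universal U -> exists c, forall p u x,
  ev f (Node (bits_tree p) (bits_tree u)) (bits_tree x) ->
  complexity U x u <= size p + c.
Proof.
move=> /(_ (code_machine f))[c Hc]; exists c => p u x /computes_code Hx.
have [q [sq Hq]] := Hc p; apply: leq_trans sq.
by apply: complexity_le; apply/Hq.
Qed.

(** * Computable functions *)

Class Enc (T : Type) := enc : T -> tree.

#[export] Instance enc_bool : Enc bool := bit_tree.
#[export] Instance enc_tree : Enc tree := id.
#[export] Instance enc_seq T `{Enc T} : Enc (seq T) :=
  foldr (fun a => Node (enc a)) Leaf.
(** Unary, since running time does not matter: a number is then a list over which one can fold. *)
#[export] Instance enc_nat : Enc nat := fun n => enc (nseq n Leaf).
#[export] Instance enc_prod A B `{Enc A, Enc B} : Enc (A * B) :=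
  fun x => Node (enc x.1) (enc x.2).

(** Not declared as an instance in general, so that [bool] keeps one encoding. *)
Definition enc_fin (T : finType) : Enc T := fun x => enc (nat_of_ord (enum_rank x)).
Arguments enc_fin : clear implicits.

Definition computable {X Y} `{Enc X, Enc Y} (f : X -> Y) : Prop :=
  exists c, forall x, ev c (enc x) (enc (f x)).

Section Closure.
Context {X : Type} `{EX : Enc X}.

Lemma c_id : computable (fun x : X => x).
Proof. by exists Id => x; apply: ev_id. Qed.

Lemma c_const Y `{Enc Y} (y : Y) : computable (fun _ : X => y).
Proof.
suff H' t : exists c, forall x, ev c x t.
  by have [c Hc] := H' (enc y); exists c => x; apply: Hc.
elim: t => [|l [cl Hl] r [cr Hr]]; first by exists Nil => x; apply: ev_nil.
by exists (Pair cl cr) => x; apply: ev_pair.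
Qed.

Lemma c_comp Y Z `{Enc Y, Enc Z} (f : Y -> Z) (g : X -> Y) :
  computable f -> computable g -> computable (fun x => f (g x)).
Proof.
by move=> [c Hc] [d Hd]; exists (Comp c d) => x; apply: ev_comp (Hd x) (Hc _).
Qed.

Lemma c_pair Y Z `{Enc Y, Enc Z} (f : X -> Y) (g : X -> Z) :
  computable f -> computable g -> computable (fun x => (f x, g x)).
Proof. by move=> [c Hc] [d Hd]; exists (Pair c d) => x; apply: ev_pair. Qed.

Lemma c_fst Y Z `{Enc Y, Enc Z} (f : X -> Y * Z) :
  computable f -> computable (fun x => (f x).1).
Proof. by move=> Hf; apply: c_comp Hf; exists Hd => x; apply: ev_hd. Qed.

Lemma c_snd Y Z `{Enc Y, Enc Z} (f : X -> Y * Z) :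
  computable f -> computable (fun x => (f x).2).
Proof. by move=> Hf; apply: c_comp Hf; exists Tl => x; apply: ev_tl. Qed.

Lemma c_if Y `{Enc Y} (b : X -> bool) (f g : X -> Y) :
  computable b -> computable f -> computable g ->
  computable (fun x => if b x then f x else g x).
Proof.
move=> [cb Hb] [cf Hf] [cg Hg]; exists (Comp (Cond cf cg) (Pair cb Id)) => x.
apply: ev_comp (ev_pair (Hb x) (ev_id _)) _.
by case: (b x); [apply: ev_cond_true | apply: ev_cond_false].
Qed.

Lemma c_nil Y `{Enc Y} : computable (fun _ : X => [::] : seq Y).
Proof. exact: c_const. Qed.

Lemma c_cons Y `{Enc Y} (f : X -> Y) (g : X -> seq Y) :
  computable f -> computable g -> computable (fun x => f x :: g x).
Proof. by move=> [c Hc] [d Hd]; exists (Pair c d) => x; apply: ev_pair. Qed.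

Lemma c_case Y Z `{Enc Y, Enc Z} (l : X -> seq Y) (f : X -> Y -> seq Y -> Z)
    (g : X -> Z) :
  computable l -> computable (fun y => f y.1 y.2.1 y.2.2) -> computable g ->
  computable (fun x => if l x is a :: s then f x a s else g x).
Proof.
move=> [cl Hl] [cf Hf] [cg Hg].
exists (Comp (Cond cf (Comp cg Hd)) (Pair cl (Pair Id cl))) => x.
apply: ev_comp (ev_pair (Hl x) (ev_pair (ev_id _) (Hl x))) _.
case: (l x) => [|a s].
  by apply: ev_cond_false; apply: ev_comp (ev_hd _ _) (Hg x).
exact: ev_cond_true (Hf (x, (a, s))).
Qed.

Lemma c_foldl Y Z `{Enc Y, Enc Z} (f : X -> Z -> Y -> Z) (g : X -> Z)
    (l : X -> seq Y) :
  computable (fun y => f y.1.1 y.1.2 y.2) -> computable g -> computable l ->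
  computable (fun x => foldl (f x) (g x) (l x)).
Proof.
move=> [cf Hf] [cg Hg] [cl Hl].
pose B := Comp Hd Tl; pose L := Comp Tl Tl.
pose A := Comp Hd L; pose S := Comp Tl L.
(* [Loop] consumes the left subtree that it tests, so the remaining list is kept twice: as the test,
   and inside the state [(x, (z, s))] passed to the body. *)
pose body := Pair S (Pair Hd (Pair (Comp cf (Pair (Pair Hd B) A)) S)).
exists (Comp (Comp B (Loop body)) (Pair cl (Pair Id (Pair cg cl)))) => x.
apply: ev_comp (ev_pair (Hl x) (ev_pair (ev_id _) (ev_pair (Hg x) (Hl x)))) _.
apply: (ev_comp (y := enc (x, (foldl (f x) (g x) (l x), [::] : seq Y)))); last first.
  exact: ev_comp (ev_tl _ _) (ev_hd _ _).
elim: (l x) (g x) => [|a s IH] z /=; first exact: ev_loop_end.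
apply: (@ev_loop _ _ _ _
  (Node (enc s) (Node (enc x) (Node (enc (f x z a)) (enc s))))) (IH (f x z a)).
have HL t u v : ev L (Node t (Node u v)) v by apply: ev_comp; [apply: ev_tl|apply: ev_tl].
have HS t u v w : ev S (Node t (Node u (Node v w))) w.
  by apply: ev_comp (HL _ _ _) (ev_tl _ _).
apply: ev_pair; first exact: HS.
apply: ev_pair; first exact: ev_hd.
apply: ev_pair; last exact: HS.
apply: ev_comp _ (Hf (x, z, a)).
apply: (ev_pair (y := Node (enc x) (enc z))); last first.
  exact: ev_comp (HL _ _ _) (ev_hd _ _).
by apply: ev_pair (ev_hd _ _) _; apply: ev_comp (ev_tl _ _) (ev_hd _ _).
Qed.

Lemma c_iter Y `{Enc Y} (n : X -> nat) (f : X -> Y -> Y) (g : X -> Y) :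
  computable n -> computable (fun y => f y.1 y.2) -> computable g ->
  computable (fun x => iter (n x) (f x) (g x)).
Proof.
move=> [cn Hn] [cf Hf] Hg.
have -> : (fun x => iter (n x) (f x) (g x)) =
    (fun x => foldl (fun y (_ : tree) => f x y) (g x) (nseq (n x) Leaf)).
  apply: funext => x; elim: (n x) (g x) => [|k IH] y //.
  by rewrite iterSr IH.
apply: c_foldl => //; last by exists cn.
exists (Comp cf Hd) => y; exact: ev_comp (ev_hd _ _) (Hf _).
Qed.

Lemma c_succ (n : X -> nat) : computable n -> computable (fun x => (n x).+1).
Proof.
by move=> [c Hc]; exists (Pair Nil c) => x; apply: ev_pair (Hc x); apply: ev_nil.
Qed.

End Closure.

Ltac comp_lib := fail.
(* The goal is dispatched on its head symbol, since unification would unfold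
   the recursive functions of the library. *)
Ltac comp_step :=
  lazymatch goal with
  | |- computable (fun x => x) => exact: c_id
  | |- computable (fun _ => ?y) => exact: c_const
  | |- computable fst => exact: (c_fst c_id)
  | |- computable snd => exact: (c_snd c_id)
  | |- computable (fun x => (_, _)) => apply: c_pair
  | |- computable (fun x => fst _) => apply: c_fst
  | |- computable (fun x => snd _) => apply: c_snd
  | |- computable (fun x => _ :: _) => apply: c_cons
  | |- computable (fun x => foldl _ _ _) => apply: c_foldl
  | |- computable (fun x => iter _ _ _) => apply: c_iter
  | |- computable (fun x => _.+1) => apply: c_succ
  | |- computable (fun x => if _ then _ else _) => apply: c_if
  | |- computable (fun x => match _ with nil => _ | cons _ _ => _ end) => apply: c_case
  | |- _ => comp_lib
  end.
Ltac comp := repeat (cbv beta; first [assumption | comp_step]).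

Lemma c_negb X `{Enc X} (b : X -> bool) : computable b -> computable (fun x => ~~ b x).
Proof. by move=> Hb; apply: (c_if Hb (c_const false) (c_const true)). Qed.

Lemma c_andb X `{Enc X} (b c : X -> bool) :
  computable b -> computable c -> computable (fun x => b x && c x).
Proof. by move=> Hb Hc; apply: (c_if Hb Hc (c_const false)). Qed.

Lemma c_pred X `{Enc X} (n : X -> nat) : computable n -> computable (fun x => (n x).-1).
Proof.
move=> [cn Hn]; have Hs : computable (fun x => nseq (n x) Leaf) by exists cn.
have [c Hc] : computable (fun x =>
    if nseq (n x) Leaf is _ :: s then s else [::]) by comp.
by exists c => x; have := Hc x; case: (n x).
Qed.

Lemma c_sub X `{Enc X} (m n : X -> nat) :
  computable m -> computable n -> computable (fun x => m x - n x).
Proof.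
move=> Hm Hn; under eq_fun do rewrite -iter_predn.
by apply: c_iter => //; apply: c_pred; comp.
Qed.

Lemma c_leq X `{Enc X} (m n : X -> nat) :
  computable m -> computable n -> computable (fun x => m x <= n x).
Proof.
move=> Hm Hn.
have Hs : computable (fun x => nseq (m x - n x) Leaf).
  by have [c Hc] := c_sub Hm Hn; exists c.
have -> : (fun x => m x <= n x) =
    (fun x => if nseq (m x - n x) Leaf is _ :: _ then false else true).
  by apply: funext => x; rewrite -subn_eq0; case: (m x - n x).
by comp.
Qed.

Lemma c_add X `{Enc X} (m n : X -> nat) :
  computable m -> computable n -> computable (fun x => m x + n x).
Proof.
move=> Hm Hn; have -> : (fun x => m x + n x) = (fun x => iter (m x) S (n x)).
  by apply: funext => x; rewrite iter_succn addnC.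
by comp.
Qed.

Lemma c_double X `{Enc X} (n : X -> nat) : computable n -> computable (fun x => (n x).*2).
Proof. by move=> Hn; under eq_fun do rewrite -addnn; apply: c_add. Qed.

Lemma c_exp2 X `{Enc X} (n : X -> nat) : computable n -> computable (fun x => 2 ^ n x).
Proof.
move=> Hn; have -> : (fun x => 2 ^ n x) = (fun x => iter (n x) double 1).
  apply: funext => x; elim: (n x) => //= k <-.
  by rewrite expnS mul2n.
by apply: c_iter; comp; apply: c_double; comp.
Qed.

Lemma c_rev X Y `{Enc X, Enc Y} (l : X -> seq Y) :
  computable l -> computable (fun x => rev (l x)).
Proof.
move=> Hl; have -> : (fun x => rev (l x)) =
    (fun x => foldl (fun s a => a :: s) [::] (l x)).
  by apply: funext => x; rewrite /rev; elim: (l x) [::] => //=.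
by comp.
Qed.

Lemma c_foldr X Y Z `{Enc X, Enc Y, Enc Z} (f : X -> Y -> Z -> Z) (g : X -> Z)
    (l : X -> seq Y) :
  computable (fun y => f y.1.1 y.2 y.1.2) -> computable g -> computable l ->
  computable (fun x => foldr (f x) (g x) (l x)).
Proof.
move=> Hf Hg Hl; have -> : (fun x => foldr (f x) (g x) (l x)) =
    (fun x => foldl (fun z a => f x a z) (g x) (rev (l x))).
  by apply: funext => x; rewrite foldl_rev.
by apply: c_foldl => //; apply: c_rev.
Qed.

Lemma c_map X Y Z `{Enc X, Enc Y, Enc Z} (f : X -> Y -> Z) (l : X -> seq Y) :
  computable (fun y => f y.1 y.2) -> computable l ->
  computable (fun x => [seq f x a | a <- l x]).
Proof.
move=> Hf Hl; have -> : (fun x => [seq f x a | a <- l x]) =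
    (fun x => foldr (fun a s => f x a :: s) [::] (l x)).
  by apply: funext => x; elim: (l x) => //= a s ->.
apply: c_foldr; comp.
by apply: (c_comp (g := fun y : X * seq Z * Y => (y.1.1, y.2)) Hf); comp.
Qed.

Lemma c_filter X Y `{Enc X, Enc Y} (b : X -> Y -> bool) (l : X -> seq Y) :
  computable (fun y => b y.1 y.2) -> computable l ->
  computable (fun x => [seq a <- l x | b x a]).
Proof.
move=> Hb Hl; have -> : (fun x => [seq a <- l x | b x a]) =
    (fun x => foldr (fun a s => if b x a then a :: s else s) [::] (l x)).
  by apply: funext => x; elim: (l x) => //= a s ->.
apply: c_foldr; comp.
by apply: (c_comp (g := fun y : X * seq Y * Y => (y.1.1, y.2)) Hb); comp.
Qed.

Lemma c_cat X Y `{Enc X, Enc Y} (s t : X -> seq Y) :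
  computable s -> computable t -> computable (fun x => s x ++ t x).
Proof.
move=> Hs Ht; have -> : (fun x => s x ++ t x) =
    (fun x => foldr cons (t x) (s x)).
  by apply: funext => x; elim: (s x) => //= a u ->.
by apply: c_foldr; comp.
Qed.

Lemma c_size X Y `{Enc X, Enc Y} (l : X -> seq Y) :
  computable l -> computable (fun x => size (l x)).
Proof.
move=> Hl; have -> : (fun x => size (l x)) =
    (fun x => foldr (fun _ n => n.+1) 0 (l x)).
  by apply: funext => x; elim: (l x) => //= a u ->.
by apply: c_foldr; comp.
Qed.

Lemma c_count X Y `{Enc X, Enc Y} (b : X -> Y -> bool) (l : X -> seq Y) :
  computable (fun y => b y.1 y.2) -> computable l ->
  computable (fun x => count (b x) (l x)).
Proof.
move=> Hb Hl; under eq_fun do rewrite -size_filter.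
by apply: c_size; apply: c_filter.
Qed.

Lemma c_behead X Y `{Enc X, Enc Y} (l : X -> seq Y) :
  computable l -> computable (fun x => behead (l x)).
Proof.
move=> Hl; have -> : (fun x => behead (l x)) =
    (fun x => if l x is _ :: s then s else [::]).
  by apply: funext => x; case: (l x).
by comp.
Qed.

Lemma c_head X Y `{Enc X, Enc Y} (d : X -> Y) (l : X -> seq Y) :
  computable d -> computable l -> computable (fun x => head (d x) (l x)).
Proof.
move=> Hd Hl; have -> : (fun x => head (d x) (l x)) =
    (fun x => if l x is a :: _ then a else d x).
  by apply: funext => x; case: (l x).
by comp.
Qed.

Lemma c_drop X Y `{Enc X, Enc Y} (n : X -> nat) (l : X -> seq Y) :
  computable n -> computable l -> computable (fun x => drop (n x) (l x)).
Proof.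
move=> Hn Hl; have -> : (fun x => drop (n x) (l x)) =
    (fun x => iter (n x) behead (l x)).
  apply: funext => x; elim: (n x) (l x) => [|k IH] s; first exact: drop0.
  by rewrite iterSr -IH; case: s.
by comp; apply: c_behead; comp.
Qed.

Lemma c_take X Y `{Enc X, Enc Y} (n : X -> nat) (l : X -> seq Y) :
  computable n -> computable l -> computable (fun x => take (n x) (l x)).
Proof.
move=> Hn Hl; have -> : (fun x => take (n x) (l x)) =
    (fun x => rev (drop (size (l x) - n x) (rev (l x)))).
  apply: funext => x; rewrite drop_rev revK.
  case: (leqP (n x) (size (l x))) => nl; first by rewrite subKn.
  by rewrite (eqP (ltnW nl)) subn0 take_size take_oversize // ltnW.
apply: c_rev; apply: c_drop; last exact: c_rev.
by apply: c_sub => //; apply: c_size.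
Qed.

Lemma c_nth X Y `{Enc X, Enc Y} (d : X -> Y) (l : X -> seq Y) (n : X -> nat) :
  computable d -> computable l -> computable n ->
  computable (fun x => nth (d x) (l x) (n x)).
Proof.
move=> Hd Hl Hn; have -> : (fun x => nth (d x) (l x) (n x)) =
    (fun x => head (d x) (drop (n x) (l x))).
  by apply: funext => x; rewrite -nth0 nth_drop addn0.
by apply: c_head => //; apply: c_drop.
Qed.

Lemma c_eqbits X `{Enc X} (s t : X -> bits) :
  computable s -> computable t -> computable (fun x => s x == t x).
Proof.
(* State of a pass over the first word: whether the words agree so far, and what remains of the
   second. Equality also requires that nothing remains. *)
pose f (st : bool * bits) (a : bool) :=
  if st.2 is b :: u then (if a then st.1 && b else st.1 && ~~ b, u)
  else (false, [::]).
move=> Hs Ht; have -> : (fun x => s x == t x) =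
    (fun x => if (foldl f (true, t x) (s x)).2 is _ :: _ then false
              else (foldl f (true, t x) (s x)).1).
  apply: funext => x.
  have fF u v : (foldl f (false, u) v).1 = false.
    elim: v u => //= a v IH [|b u]; rewrite /f /=; first exact: IH.
    by case: a; apply: IH.
  elim: (s x) (t x) => [|a u IH] [|b v] //=.
    have -> : f (true, [::]) a = (false, [::]) by [].
    by rewrite fF; case: (_.2).
  have -> : f (true, b :: v) a = (a == b, v) by case: a; case: b.
  rewrite eqseq_cons; case: (a == b) => //=.
  by rewrite fF; case: (_.2).
have Hf : computable (fun y : X * (bool * bits) * bool => f y.1.2 y.2).
  by rewrite /f; comp; apply: c_andb; comp; apply: c_negb; comp.
by comp.
Qed.

Lemma c_mem X `{Enc X} (s : X -> bits) (l : X -> seq bits) :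
  computable s -> computable l -> computable (fun x => s x \in l x).
Proof.
move=> Hs Hl; have -> : (fun x => s x \in l x) =
    (fun x => foldr (fun t b => if s x == t then true else b) false (l x)).
  apply: funext => x; elim: (l x) => //= t l' <-.
  by rewrite inE; case: (_ == _).
apply: c_foldr; comp; apply: c_eqbits; comp.
by apply: (c_comp Hs); comp.
Qed.
(** Any function on a finite type is a table lookup. This is how the transition table of an
    arbitrary machine becomes part of a code. *)
Lemma c_fin X (A : finType) Y `{Enc X, Enc Y} (f : A -> Y) (g : X -> A) :
  @computable _ _ _ (enc_fin A) g -> computable (fun x => f (g x)).
Proof.
move=> Hg; have [[a]|nA] := pselect (inhabited A); last first.
  by exists Id => x; case: nA; exists; apply: g x.
have -> : (fun x => f (g x)) =
    (fun x => nth (f a) [seq f b | b <- enum A] (enum_rank (g x))).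
  apply: funext => x; rewrite (nth_map a) ?nth_enum_rank //.
  by rewrite -cardE.
apply: c_nth; [exact: c_const | exact: c_const|].
by have [c Hc] := Hg; exists c.
Qed.

Lemma c_fin2 X (A B : finType) Y `{Enc X, Enc Y} (f : A -> B -> Y)
    (g : X -> A) (h : X -> B) :
  @computable _ _ _ (enc_fin A) g -> @computable _ _ _ (enc_fin B) h ->
  computable (fun x => f (g x) (h x)).
Proof.
move=> Hg Hh; have [[x0]|nX] := pselect (inhabited X); last first.
  by exists Id => x; case: nX; exists.
have -> : (fun x => f (g x) (h x)) =
    (fun x => nth (f (g x0) (h x0)) [seq f (g x) b | b <- enum B] (enum_rank (h x))).
  apply: funext => x; rewrite (nth_map (h x0)) ?nth_enum_rank //.
  by rewrite -cardE.
apply: c_nth; first exact: c_const.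
  exact: (c_fin (fun a => [seq f a b | b <- enum B])).
by have [c Hc] := Hh; exists c.
Qed.

Ltac comp_lib ::=
  lazymatch goal with
  | |- computable (fun x => ~~ _) => apply: c_negb
  | |- computable (fun x => _ && _) => apply: c_andb
  | |- computable (fun x => leq _ _) => apply: c_leq
  | |- computable (fun x => addn _ _) => apply: c_add
  | |- computable (fun x => double _) => apply: c_double
  | |- computable (fun x => expn 2 _) => apply: c_exp2
  | |- computable (fun x => rev _) => apply: c_rev
  | |- computable (fun x => foldr _ _ _) => apply: c_foldr
  | |- computable (fun x => map _ _) => apply: c_map
  | |- computable (fun x => filter _ _) => apply: c_filter
  | |- computable (fun x => cat _ _) => apply: c_cat
  | |- computable (fun x => size _) => apply: c_size
  | |- computable (fun x => count _ _) => apply: c_count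
  | |- computable (fun x => behead _) => apply: c_behead
  | |- computable (fun x => head _ _) => apply: c_head
  | |- computable (fun x => drop _ _) => apply: c_drop
  | |- computable (fun x => take _ _) => apply: c_take
  | |- computable (fun x => nth _ _ _) => apply: c_nth
  | |- computable (fun x => @eq_op _ _ _) => apply: c_eqbits
  | |- computable (fun x => in_mem _ _) => apply: c_mem
  end.

(** * Simulation of Turing machines *)

#[export] Instance enc_move : Enc move := fun m =>
  match m with
  | Stay => enc (false, false)
  | MoveLeft => enc (true, false)
  | MoveRight => enc (false, true)
  end.

#[export] Instance enc_tape A `{Enc (option A)} : Enc (tape A) :=
  fun t => enc (tleft t, (tcur t, tright t)).

Section Simulation.
Variable M : TM.
Local Notation K := (work_tapes M).+3.
Local Notation L := (letter M).
Local Notation Z := (state M * {ffun 'I_K -> option L})%type.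

#[local] Instance enc_state : Enc (state M) := enc_fin (state M).
#[local] Instance enc_letter : Enc (option L) := enc_fin (option L).
#[local] Instance enc_view : Enc Z := enc_fin Z.

(** A configuration holds its tapes as a function; listing them turns it into data that can be
    encoded. *)
Definition snap : Type := state M * seq (tape L).

Definition blank : tape L := Tape [::] None [::].

Definition snapshot (c : config M) : snap :=
  (cstate c, [seq ctapes c i | i <- enum 'I_K]).

(** The transition is looked up at an element of the finite type [Z]. That element is filled in one
    tape at a time, so that each stage is itself a function of two finite arguments. *)
Definition see (i : 'I_K) (z : Z) (a : option L) : Z :=
  (z.1, [ffun j => if j == i then a else z.2 j]).

Definition view (s : snap) : Z :=
  foldl (fun z i => see i z (tcur (nth blank s.2 i))) (s.1, [ffun => None])
    (enum 'I_K).

Definition next_state (z : Z) : state M := (delta z.1 z.2).1.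

Definition next_action (i : 'I_K) (z : Z) : option L * move := (delta z.1 z.2).2 i.

Definition update (s : snap) (i : 'I_K) : tape L :=
  tape_move (next_action i (view s)).2
    (tape_write (next_action i (view s)).1 (nth blank s.2 i)).

Definition snap_step (s : snap) : snap :=
  if halting s.1 then s
  else (next_state (view s), [seq update s i | i <- enum 'I_K]).

(** [letter_of_bit] is spelt as a conditional because [bool] is not encoded by [enc_fin]. *)
Definition input_tape_of (w : bits) : tape L :=
  Tape [::] (head None [seq (if b then Some (letter_of_bit M true)
                             else Some (letter_of_bit M false)) | b <- w])
    (behead [seq (if b then Some (letter_of_bit M true)
                  else Some (letter_of_bit M false)) | b <- w]).

Definition snap_init (p u : bits) : snap :=
  (start M, input_tape_of p :: input_tape_of u ::
     nseq (work_tapes M).+1 (input_tape M [::])).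

Definition bit_letter (b : bool) (a : option L) : bool :=
  a == Some (letter_of_bit M b).

Definition snap_output (s : snap) : bits :=
  foldr (fun a w => if bit_letter true a then true :: w
                    else if bit_letter false a then false :: w else [::])
    [::] (tcur (nth blank s.2 2) :: tright (nth blank s.2 2)).

Lemma nth_snapshot c (i : 'I_K) : nth blank (snapshot c).2 i = ctapes c i.
Proof. by rewrite (nth_map ord0) ?size_enum_ord // nth_ord_enum. Qed.

Lemma view_snapshot c :
  view (snapshot c) = (cstate c, [ffun i => tcur (ctapes c i)]).
Proof.
have H r z : foldl (fun z i => see i z (tcur (nth blank (snapshot c).2 i))) z r =
    (z.1, [ffun i => if i \in r then tcur (ctapes c i) else z.2 i]).
  elim: r z => [|i r IH] z /=.
    by rewrite [LHS]surjective_pairing; congr pair; apply/ffunP => j; rewrite ffunE.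
  rewrite IH; congr pair; apply/ffunP => j.
  rewrite !ffunE inE nth_snapshot.
  by case: (eqVneq j i) => [->|] //=; rewrite if_same.
by rewrite /view H; congr pair; apply/ffunP => j; rewrite !ffunE mem_enum.
Qed.

Lemma snap_stepE c : snap_step (snapshot c) = snapshot (step c).
Proof.
rewrite /snap_step /step /=; case: ifP => // _.
rewrite /next_state /update /next_action view_snapshot /=.
case: (delta _ _) => q a /=; congr pair.
by apply: eq_map => i; rewrite nth_snapshot.
Qed.

Lemma input_tape_ofE w : input_tape_of w = input_tape M w.
Proof.
rewrite /input_tape_of /input_tape.
have -> // : [seq (if b then Some (letter_of_bit M true)
    else Some (letter_of_bit M false)) | b <- w] =
  [seq Some (letter_of_bit M b) | b <- w].
by apply: eq_map => -[].
Qed.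

Lemma snap_initE p u : snap_init p u = snapshot (init M p u).
Proof.
rewrite /snap_init !input_tape_ofE; congr pair.
apply: (@eq_from_nth _ blank).
  by rewrite size_map size_enum_ord /= size_ncons addn0.
move=> i; rewrite [size _]/= size_ncons addn0 => iK.
rewrite (nth_snapshot (init M p u) (Ordinal iK)) /=.
case: i iK => [|[|i]] iK //=.
by have := nth_nseq blank (work_tapes M).+1 (input_tape M [::]) i; rewrite ifT.
Qed.

Lemma snap_outputE c : snap_output (snapshot c) = output c.
Proof.
rewrite /snap_output /output -[2](@inordK (work_tapes M).+2) //.
rewrite nth_snapshot inordK //.
elim: (_ :: _) => //= -[a|] s IH //=.
by rewrite IH.
Qed.

Lemma c_tleft X `{Enc X} (t : X -> tape L) :
  computable t -> computable (fun x => tleft (t x)).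
Proof. by move=> [c Hc]; exists (Comp Hd c) => x; apply: ev_comp (Hc x) (ev_hd _ _). Qed.

Lemma c_tcur X `{Enc X} (t : X -> tape L) :
  computable t -> computable (fun x => tcur (t x)).
Proof.
move=> [c Hc]; exists (Comp (Comp Hd Tl) c) => x; apply: ev_comp (Hc x) _.
exact: ev_comp (ev_tl _ _) (ev_hd _ _).
Qed.

Lemma c_tright X `{Enc X} (t : X -> tape L) :
  computable t -> computable (fun x => tright (t x)).
Proof.
move=> [c Hc]; exists (Comp (Comp Tl Tl) c) => x; apply: ev_comp (Hc x) _.
exact: ev_comp (ev_tl _ _) (ev_tl _ _).
Qed.

Lemma c_Tape X `{Enc X} (l r : X -> seq (option L)) (a : X -> option L) :
  computable l -> computable a -> computable r ->
  computable (fun x => Tape (l x) (a x) (r x)).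
Proof.
move=> Hl Ha Hr.
have [c Hc] := c_pair Hl (c_pair Ha Hr).
by exists c.
Qed.

Lemma c_tape_write X `{Enc X} (a : X -> option L) (t : X -> tape L) :
  computable a -> computable t -> computable (fun x => tape_write (a x) (t x)).
Proof. by move=> Ha Ht; apply: c_Tape => //; [apply: c_tleft|apply: c_tright]. Qed.

Lemma c_tape_move X `{Enc X} (m : X -> move) (t : X -> tape L) :
  computable m -> computable t -> computable (fun x => tape_move (m x) (t x)).
Proof.
move=> [cm Hm] Ht.
pose lft m := if m is MoveLeft then true else false.
pose rgt m := if m is MoveRight then true else false.
have Hl : computable (fun x => lft (m x)).
  by exists (Comp Hd cm) => x; apply: ev_comp (Hm x) _; case: (m x); apply: ev_hd.
have Hr : computable (fun x => rgt (m x)).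
  by exists (Comp Tl cm) => x; apply: ev_comp (Hm x) _; case: (m x); apply: ev_tl.
have -> : (fun x => tape_move (m x) (t x)) = (fun x =>
    if lft (m x) then Tape (behead (tleft (t x))) (head None (tleft (t x)))
                        (tcur (t x) :: tright (t x))
    else if rgt (m x) then Tape (tcur (t x) :: tleft (t x))
                        (head None (tright (t x))) (behead (tright (t x)))
    else t x).
  by apply: funext => x; case: (m x).
have Htl := c_tleft Ht; have Htr := c_tright Ht; have Htc := c_tcur Ht.
by comp; apply: c_Tape; comp.
Qed.

Lemma c_view : computable view.
Proof.
rewrite /view.
(* The number of tapes is fixed by [M], so the fold is unrolled into the code, one fragment per
   tape. *)
have H r (z : snap -> Z) : computable z -> computable (fun s : snap =>
    foldl (fun z i => see i z (tcur (nth blank s.2 i))) (z s) r).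
  elim: r z => //= i r IH z Hz; apply: IH.
  by apply: c_fin2 => //; apply: c_tcur; comp.
by apply: H; apply: (c_fin (fun q => (q, [ffun => None]) : Z)); comp.
Qed.

Lemma c_snap_step X `{Enc X} (s : X -> snap) :
  computable s -> computable (fun x => snap_step (s x)).
Proof.
apply: c_comp; rewrite /snap_step.
have Hr (r : seq 'I_K) : computable (fun s : snap => [seq update s i | i <- r]).
  elim: r => [|i r IH] /=; first exact: c_nil.
  apply: c_cons => //; apply: c_tape_move.
    by apply: c_snd; apply: (c_fin _ c_view).
  by apply: c_tape_write; comp; apply: (c_fin _ c_view).
have Hh : computable (fun s : snap => halting s.1) by apply: c_fin; comp.
by have := Hr (enum 'I_K) => HE; comp; apply: (c_fin _ c_view).
Qed.

Lemma c_snap_init X `{Enc X} (p u : X -> bits) :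
  computable p -> computable u -> computable (fun x => snap_init (p x) (u x)).
Proof.
move=> Hp Hu; rewrite /snap_init /input_tape_of; comp; apply: c_Tape; comp.
Qed.

Lemma c_snap_output X `{Enc X} (s : X -> snap) :
  computable s -> computable (fun x => snap_output (s x)).
Proof.
apply: c_comp; rewrite /snap_output; comp.
- by apply: c_fin; comp.
- by apply: c_fin; comp.
- by apply: c_tcur; comp.
by apply: c_tright; comp.
Qed.

Lemma c_snap_halting X `{Enc X} (s : X -> snap) :
  computable s -> computable (fun x => halting (s x).1).
Proof. by move=> Hs; apply: c_fin; comp. Qed.

Definition snap_run (t : nat) (p u : bits) : snap :=
  iter t snap_step (snap_init p u).

Lemma snap_runE t p u : snap_run t p u = snapshot (iter t (@step M) (init M p u)).
Proof.
elim: t => [|t IH]; first exact: snap_initE.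
by rewrite /snap_run iterS -/(snap_run t p u) IH snap_stepE.
Qed.

Lemma computes_snap p u x : computes M p u x <->
  exists t, halting (snap_run t p u).1 /\ snap_output (snap_run t p u) = x.
Proof.
by split=> -[t H]; exists t; move: H; rewrite snap_runE snap_outputE.
Qed.

Definition halted (t : nat) (p u : bits) : bool := halting (snap_run t p u).1.

Definition result (t : nat) (p u : bits) : bits := snap_output (snap_run t p u).

Lemma computes_halted p u x :
  computes M p u x <-> exists2 t, halted t p u & result t p u = x.
Proof. by rewrite computes_snap; split=> [[t []]|[t]]; exists t. Qed.

Lemma c_snap_run X `{Enc X} (t : X -> nat) (p u : X -> bits) :
  computable t -> computable p -> computable u ->
  computable (fun x => snap_run (t x) (p x) (u x)).
Proof.
move=> Ht Hp Hu; apply: c_iter => //; last exact: c_snap_init.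
by apply: c_snap_step; comp.
Qed.

Lemma c_halted X `{Enc X} (t : X -> nat) (p u : X -> bits) :
  computable t -> computable p -> computable u ->
  computable (fun x => halted (t x) (p x) (u x)).
Proof. by move=> Ht Hp Hu; apply/c_snap_halting/c_snap_run. Qed.

Lemma c_result X `{Enc X} (t : X -> nat) (p u : X -> bits) :
  computable t -> computable p -> computable u ->
  computable (fun x => result (t x) (p x) (u x)).
Proof. by move=> Ht Hp Hu; apply/c_snap_output/c_snap_run. Qed.

Lemma halted_stable t t' p u : t <= t' -> halted t p u ->
  snap_run t' p u = snap_run t p u.
Proof.
move=> /subnK <-; elim: (t' - t) => // k IH Ht.
by rewrite addSn /snap_run iterS -/(snap_run (k + t) p u) IH // /snap_step ifT.
Qed.
End Simulation.

(** * Partial computable relations and unbounded search *)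

Definition semicomputable {X Y} `{Enc X, Enc Y} (R : X -> Y -> Prop) : Prop :=
  exists c, forall x y, R x y -> ev c (enc x) (enc y).

Lemma s_total X Y `{Enc X, Enc Y} (f : X -> Y) :
  computable f -> semicomputable (fun x y => y = f x).
Proof. by move=> [c Hc]; exists c => x _ ->. Qed.

Lemma s_comp X Y Z `{Enc X, Enc Y, Enc Z} (R : X -> Y -> Prop) (S : Y -> Z -> Prop) :
  semicomputable R -> semicomputable S ->
  semicomputable (fun x z => exists2 y, R x y & S y z).
Proof.
move=> [c Hc] [d Hd]; exists (Comp d c) => x z [y Rxy Syz].
exact: ev_comp (Hc _ _ Rxy) (Hd _ _ Syz).
Qed.

Lemma s_pair X Y Z `{Enc X, Enc Y, Enc Z} (R : X -> Y -> Prop) (S : X -> Z -> Prop) :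
  semicomputable R -> semicomputable S ->
  semicomputable (fun x yz => R x yz.1 /\ S x yz.2).
Proof.
move=> [c Hc] [d Hd]; exists (Pair c d) => x [y z] [Rxy Sxz].
exact: ev_pair (Hc _ _ Rxy) (Hd _ _ Sxz).
Qed.

Lemma s_search X `{Enc X} (t : X -> bool) (g : X -> X) :
  computable t -> computable g ->
  semicomputable (fun x y => exists m, [/\ y = iter m g x, t y
    & forall j, j < m -> ~~ t (iter j g x)]).
Proof.
move=> Ht [cg Hg]; have [ct Hct] := c_negb Ht.
pose test := Pair ct Id.
exists (Comp (Loop (Comp test cg)) test) => x y [m [-> tm nt]].
have Htest z : ev test (enc z) (Node (enc (~~ t z)) (enc z)).
  by apply: ev_pair => //; apply: ev_id.
apply: ev_comp (Htest x) _; elim: m x nt tm => [|m IH] x nt tm /=.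
  by rewrite tm; apply: ev_loop_end.
rewrite (nt 0) //; apply: ev_loop; first exact: ev_comp (Hg x) (Htest _).
rewrite -iterS iterSr; apply: IH; last by rewrite -iterSr.
by move=> j jm; rewrite -iterSr; apply: nt.
Qed.

Lemma s_computes M :
  semicomputable (fun (pu : bits * bits) x => computes M pu.1 pu.2 x).
Proof.
have Ht : computable (fun y : nat * (bits * bits) => halted M y.1 y.2.1 y.2.2).
  by apply: c_halted; comp.
have Hg : computable (fun y : nat * (bits * bits) => (y.1.+1, y.2)) by comp.
have Hr : computable (fun y : nat * (bits * bits) => result M y.1 y.2.1 y.2.2).
  by apply: c_result; comp.
have [c Hc] := s_comp (s_search Ht Hg) (s_total Hr).
have [d Hd] : computable (fun pu : bits * bits => (0, pu)) by comp.
exists (Comp c d) => pu x /computes_halted[t pt <-].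
apply: ev_comp (Hd pu) _; apply: Hc.
have E m : iter m (fun y : nat * (bits * bits) => (y.1.+1, y.2)) (0, pu) = (m, pu).
  by elim: m => //= m ->.
(* The search stops at the least halting time; later snapshots are identical, hence so is the result
   read at time [t]. *)
have ex : exists t, halted M t pu.1 pu.2 by exists t.
case: (ex_minnP ex) => m Hm minm; exists (m, pu).
  exists m; rewrite E; split=> // j jm; rewrite E /=.
  by apply: contraTN jm => /minm; rewrite -leqNgt.
by rewrite /result (halted_stable (minm _ pt) Hm).
Qed.

(** * Enumeration *)

(** New words go to the end and known ones are skipped: positions never change, and they stay below
    the number of distinct words. *)
Definition insert (l : seq bits) (w : bits) : seq bits :=
  if w \in l then l else l ++ [:: w].

Section Enumeration.
Variable G : nat -> seq bits.

Fixpoint stage (s : nat) : seq bits :=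
  if s is s'.+1 then foldl insert (stage s') (G s') else [::].

Lemma mem_insert l w v : (v \in insert l w) = (v == w) || (v \in l).
Proof.
rewrite /insert; case: ifP => [wl|_]; last by rewrite mem_cat inE orbC.
by case: eqVneq => [->|].
Qed.

Lemma mem_inserts l r v : (v \in foldl insert l r) = (v \in r) || (v \in l).
Proof.
elim: r l => //= w r IH l; rewrite IH mem_insert inE.
by case: (v == w); rewrite ?orbT.
Qed.

Lemma prefix_inserts l r : prefix l (foldl insert l r).
Proof.
elim: r l => [|w r IH] l /=; first exact: prefix_refl.
apply: prefix_trans (IH _); rewrite /insert.
by case: ifP; rewrite ?prefix_refl ?prefix_prefix.
Qed.

Lemma uniq_inserts l r : uniq l -> uniq (foldl insert l r).
Proof.
elim: r l => //= w r IH l ul; apply: IH; rewrite /insert; case: ifP => // wl.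
by rewrite cats1 rcons_uniq wl.
Qed.

Lemma uniq_stage s : uniq (stage s).
Proof. by elim: s => //= s; apply: uniq_inserts. Qed.

Lemma mem_stage s v : v \in stage s -> exists s', v \in G s'.
Proof.
elim: s => //= s IH; rewrite mem_inserts.
by case/orP => [vG|/IH//]; exists s.
Qed.

Lemma prefix_stage s t : s <= t -> prefix (stage s) (stage t).
Proof.
move=> /subnK <-; elim: (t - s) => [|k IH]; first exact: prefix_refl.
by rewrite addSn /=; apply: prefix_trans IH (prefix_inserts _ _).
Qed.
End Enumeration.

(** Each stage is a prefix of the next, so the entry at a given position does not depend on the
    stage at which it is read, and the first stage that is long enough will do. *)
Lemma s_enumerate X `{Enc X} (G : X -> nat -> seq bits) :
  computable (fun y => G y.1 y.2) ->
  semicomputable (fun (xk : X * nat) w => exists s,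
    xk.2 < size (stage (G xk.1) s) /\ w = nth [::] (stage (G xk.1) s) xk.2).
Proof.
move=> HG.
pose next (y : X * nat * (nat * seq bits)) :=
  (y.1, (y.2.1.+1, foldl insert y.2.2 (G y.1.1 y.2.1))).
have Hn : computable next.
  rewrite /next /insert; comp.
  by apply: (c_comp (g := fun y : X * nat * (nat * seq bits) => (y.1.1, y.2.1)) HG); comp.
have Ht : computable (fun y : X * nat * (nat * seq bits) => y.1.2 < size y.2.2).
  by comp.
have Hr : computable (fun y : X * nat * (nat * seq bits) => nth [::] y.2.2 y.1.2).
  by comp.
have [c Hc] := s_comp (s_search Ht Hn) (s_total Hr).
have [d Hd] : computable (fun xk : X * nat => (xk, (0, [::] : seq bits))) by comp.
exists (Comp c d) => xk w [s [ks ->]].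
apply: ev_comp (Hd xk) _; apply: Hc.
have E m : iter m next (xk, (0, [::])) = (xk, (m, stage (G xk.1) m)).
  by elim: m => //= m ->.
have ex : exists s, xk.2 < size (stage (G xk.1) s) by exists s.
case: (ex_minnP ex) => m Hm minm.
exists (xk, (m, stage (G xk.1) m)) => /=.
  exists m; rewrite E; split=> // j jm; rewrite E /=.
  by apply: contraTN jm => /minm; rewrite -leqNgt.
have /prefixP[t ->] := prefix_stage (G xk.1) (minm _ ks).
by rewrite nth_cat Hm.
Qed.

(** * Decoding *)

Definition lead (w : bits) : nat :=
  foldr (fun (b : bool) n => if b then n.+1 else 0) 0 w.

Definition unpair1 (w : bits) : bits := take (lead w) (drop (lead w).+1 w).

Definition unpair2 (w : bits) : bits := drop (lead w) (drop (lead w).+1 w).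

(** The length of the word serves as fuel: every entry of a list takes at least one bit. *)
Definition unlist (w : bits) : seq bits :=
  rev (iter (size w) (fun st : bits * seq bits =>
         if st.1 is _ :: _ then (unpair2 st.1, unpair1 st.1 :: st.2) else st)
       (w, [::])).2.

Definition bits_nat (w : bits) : nat :=
  foldr (fun (b : bool) n => b + n.*2) 0 w.

Lemma lead_pair_code x y : lead (pair_code x y) = size x.
Proof. by rewrite /pair_code; elim: (size x) => //= k ->. Qed.

Lemma drop_pair_code x y : drop (size x).+1 (pair_code x y) = x ++ y.
Proof.
rewrite /pair_code -cat_rcons; apply: drop_size_cat.
by rewrite size_rcons size_nseq.
Qed.

Lemma pair_codeK1 x y : unpair1 (pair_code x y) = x.
Proof. by rewrite /unpair1 lead_pair_code drop_pair_code take_size_cat. Qed.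

Lemma pair_codeK2 x y : unpair2 (pair_code x y) = y.
Proof. by rewrite /unpair2 lead_pair_code drop_pair_code drop_size_cat. Qed.

Lemma size_pair_code x y : size (pair_code x y) = (size x).*2 + size y + 1.
Proof. by rewrite /pair_code size_cat size_nseq /= size_cat; lia. Qed.

Lemma list_codeK s : unlist (list_code s) = s.
Proof.
rewrite /unlist; set f := fun _ => _.
have H n t acc : size t <= n -> iter n f (list_code t, acc) = ([::], catrev t acc).
  elim: n t acc => [|n IH] [|w t] acc //= tn; first by rewrite (IH [::]).
  rewrite -iterS iterSr.
  have -> : f (list_code (w :: t), acc) = (list_code t, w :: acc).
    rewrite /f [(_, _).1]/= pair_codeK1 pair_codeK2.
    case E: (pair_code w (list_code t)) => [|b v] //.
    by move/(congr1 size): E; rewrite size_pair_code addn1.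
  exact: IH.
rewrite H; first exact: revK.
elim: s => //= w s IH; rewrite size_pair_code addn1 ltnS.
exact: leq_trans IH (leq_addl _ _).
Qed.

Lemma bits_nat_lt n m : m < 2 ^ n ->
  bits_nat (mkseq (fun i => odd (m %/ 2 ^ i)) n) = m.
Proof.
elim: n m => [|n IH] m; first by rewrite expn0 ltnS leqn0 => /eqP ->.
rewrite expnS mul2n => mn; rewrite /mkseq /= expn0 divn1.
have -> : [seq odd (m %/ 2 ^ i) | i <- iota 1 n] =
    mkseq (fun i => odd (m./2 %/ 2 ^ i)) n.
  rewrite /mkseq -[1]/(1 + 0) iotaDl -map_comp; apply: eq_map => i /=.
  by rewrite expnD expn1 divnMA divn2.
by rewrite IH ?odd_double_half // ltn_half_double.
Qed.

Lemma nat_codeK m : bits_nat (nat_code m) = m.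
Proof. by apply: bits_nat_lt; apply: up_logP. Qed.

Lemma size_nat_code m : size (nat_code m) = up_log 2 m.+1.
Proof. exact: size_mkseq. Qed.

Lemma size_nat_code_lt k n : k < n -> size (nat_code k) <= up_log 2 n.
Proof. by rewrite size_nat_code; apply: leq_up_log. Qed.

Lemma c_lead X `{Enc X} (w : X -> bits) :
  computable w -> computable (fun x => lead (w x)).
Proof. by move=> Hw; rewrite /lead; comp. Qed.

Lemma c_unpair1 X `{Enc X} (w : X -> bits) :
  computable w -> computable (fun x => unpair1 (w x)).
Proof. by move=> Hw; have Hl := c_lead Hw; rewrite /unpair1; comp. Qed.

Lemma c_unpair2 X `{Enc X} (w : X -> bits) :
  computable w -> computable (fun x => unpair2 (w x)).
Proof. by move=> Hw; have Hl := c_lead Hw; rewrite /unpair2; comp. Qed.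

Lemma c_unlist X `{Enc X} (w : X -> bits) :
  computable w -> computable (fun x => unlist (w x)).
Proof.
by move=> Hw; rewrite /unlist; comp; [apply: c_unpair2 | apply: c_unpair1]; comp.
Qed.

Lemma c_bits_nat X `{Enc X} (w : X -> bits) :
  computable w -> computable (fun x => bits_nat (w x)).
Proof. by move=> Hw; rewrite /bits_nat /nat_of_bool; comp. Qed.

Lemma c_pair_code X `{Enc X} (v w : X -> bits) :
  computable v -> computable w -> computable (fun x => pair_code (v x) (w x)).
Proof.
move=> Hv Hw; have -> : (fun x => pair_code (v x) (w x)) =
    (fun x => [seq true | _ <- v x] ++ false :: v x ++ w x).
  by apply: funext => x; congr cat; elim: (v x) => //= ? ? ->.
by comp.
Qed.

(** * Complexity bounds *)

Lemma complexity_semi U (R : bits * bits -> bits -> Prop) :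
  universal U -> semicomputable R ->
  exists c, forall p u x, R (p, u) x -> complexity U x u <= size p + c.
Proof.
move=> hU [f Hf]; have [c Hc] := complexity_code f hU.
by exists c => p u x /Hf; apply: Hc.
Qed.

Lemma complexity_total U (f : bits * bits -> bits) :
  universal U -> computable f ->
  exists c, forall p u, complexity U (f (p, u)) u <= size p + c.
Proof.
by move=> hU /s_total/(complexity_semi hU)[c Hc]; exists c => p u; apply: Hc.
Qed.

Lemma describable U x u : universal U -> exists p, computes U p u x.
Proof.
move=> hU; have [f Hf] : computable (fun pu : bits * bits => pu.1) by comp.
have [c Hc] := hU (code_machine f); have [q [_ Hq]] := Hc x.
by exists q; apply/Hq/computes_code; apply: (Hf (x, u)).
Qed.

Definition params_code (ps : seq nat) : bits := list_code [seq nat_code m | m <- ps].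

Definition params (w : bits) : seq nat := [seq bits_nat v | v <- unlist w].

Lemma params_codeK ps : params (params_code ps) = ps.
Proof.
rewrite /params /params_code list_codeK -map_comp map_id_in // => m _.
exact: nat_codeK.
Qed.

Lemma leq_size_params_code l l' ps :
  l <= l' -> size (params_code (l :: ps)) <= size (params_code (l' :: ps)).
Proof.
move=> ll; rewrite /params_code /= !size_pair_code !size_nat_code.
by rewrite !leq_add2r leq_double leq_up_log.
Qed.

(* To describe a string relative to [u], give a program for it relative to
   [(w, u)] together with the position of [w] in an enumeration. *)
Lemma complexity_enumerate U (G : seq nat * bits -> nat -> seq bits) :
  universal U -> computable (fun y => G y.1 y.2) ->
  exists c, forall ps u w s N q x, w \in G (ps, u) s ->
    (forall l, uniq l -> (forall v, v \in l -> exists t, v \in G (ps, u) t) ->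
       size l <= N) ->
    computes U q (pair_code w u) x ->
    complexity U x u <=
      size q + up_log 2 N + (size (params_code (up_log 2 N :: ps))).*2 + c.
Proof.
move=> hU HG.
(* Programs have the form [pair_code (params_code (m :: ps)) (nat_code k ++ q)], where the position
   [k] takes [m] bits. Only the parameters are doubled by [pair_code]; [k] and [q] cost exactly
   their length. *)
pose len (p : bits) := head 0 (params (unpair1 p)).
pose pre (pu : bits * bits) := ((behead (params (unpair1 pu.1)), pu.2),
  bits_nat (take (len pu.1) (unpair2 pu.1))).
pose aux (pu : bits * bits) := (drop (len pu.1) (unpair2 pu.1), pu.2).
pose post (y : bits * (bits * bits)) := (y.2.1, pair_code y.1 y.2.2).
have Hpar : computable (fun pu : bits * bits => params (unpair1 pu.1)).
  rewrite /params; comp; last by apply: c_unlist; apply: c_unpair1; comp.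
  by apply: c_bits_nat; comp.
have Hlen : computable (fun pu : bits * bits => len pu.1).
  by rewrite /len; comp.
have H2 : computable (fun pu : bits * bits => unpair2 pu.1).
  by apply: c_unpair2; comp.
have Hpre : computable pre by rewrite /pre; comp; apply: c_bits_nat; comp.
have Haux : computable aux by rewrite /aux; comp.
have Hpost : computable post by rewrite /post; comp; apply: c_pair_code; comp.
have := s_comp (s_pair (s_comp (s_total Hpre) (s_enumerate HG)) (s_total Haux))
  (s_comp (s_total Hpost) (s_computes U)).
move=> /(complexity_semi hU)[c Hc]; exists c.+1 => ps u w s N q x ws HN Uq.
pose l := stage (G (ps, u)) s.+1.
have wl : w \in l by rewrite mem_inserts ws.
pose k := index w l; have kl : k < size l by rewrite index_mem.
pose m := size (nat_code k).
have mN : m <= up_log 2 N.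
  apply: size_nat_code_lt; apply: leq_trans kl (HN _ (uniq_stage _ _) _) => v.
  exact: mem_stage.
have [p [par p2 sp]] : exists p, [/\ params (unpair1 p) = m :: ps,
    unpair2 p = nat_code k ++ q
    & size p = (size (params_code (m :: ps))).*2 + (m + size q) + 1].
  exists (pair_code (params_code (m :: ps)) (nat_code k ++ q)).
  by rewrite pair_codeK1 params_codeK pair_codeK2 size_pair_code size_cat.
have Elen : len p = m by rewrite /len par.
have Epre : pre (p, u) = ((ps, u), k).
  by rewrite /pre Elen par p2 take_size_cat // nat_codeK.
have Eaux : aux (p, u) = (q, u) by rewrite /aux Elen p2 drop_size_cat.
apply: leq_trans (Hc p u x _) _.
  exists (w, (q, u)); last by exists (q, pair_code w u).
  split; last by rewrite Eaux.
  by exists (ps, u, k); [rewrite Epre | exists s.+1; rewrite nth_index].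
rewrite sp; have := leq_size_params_code ps mN; lia.
Qed.

(** * Strings with short descriptions *)

Definition progs (a : nat) : seq bits :=
  iter a (fun l => [::] :: map (cons false) l ++ map (cons true) l) [:: [::]].

Lemma size_progs a : size (progs a) <= 2 ^ a.+1.
Proof.
suff : (size (progs a)).+1 = 2 ^ a.+1 by move=> <-.
elim: a => // a IH; rewrite /progs iterS -/(progs a) /= size_cat !size_map.
by rewrite expnS -IH; lia.
Qed.

Lemma mem_progs a p : (p \in progs a) = (size p <= a).
Proof.
have cons_in b c (v : bits) l : (b :: v \in map (cons c) l) = (b == c) && (v \in l).
  apply/mapP/andP => [[w wl [-> ->]]|[/eqP-> vl]]; first by rewrite eqxx.
  by exists v.
have nil_in c (l : seq bits) : ([::] \in map (cons c) l) = false.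
  by apply/mapP => -[].
elim: a p => [|a IH] [|b p] //.
rewrite /progs iterS -/(progs a) inE mem_cat !cons_in IH /= ltnS.
by case: b; rewrite ?orbF.
Qed.

Section Outputs.
Variable U : TM.

Definition outs (a s : nat) (u : bits) : seq bits :=
  foldr (fun p l => if halted U s p u then result U s p u :: l else l) [::] (progs a).

Lemma mem_outs a s u x : reflect
  (exists p, [/\ size p <= a, halted U s p u & result U s p u = x]) (x \in outs a s u).
Proof.
suff E : outs a s u = [seq result U s p u | p <- progs a & halted U s p u].
  rewrite E; apply: (iffP mapP) => [[p]|[p [pa hp <-]]].
    by rewrite mem_filter mem_progs => /andP[hp pa] ->; exists p.
  by exists p => //; rewrite mem_filter mem_progs hp.
by rewrite /outs; elim: (progs a) => //= p l ->; case: ifP.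
Qed.

Lemma size_outs a s u : size (outs a s u) <= 2 ^ a.+1.
Proof.
apply: leq_trans (size_progs a); rewrite /outs; elim: (progs a) => //= p l IH.
by case: ifP => _ //=; rewrite ltnW.
Qed.

Lemma outs_mono a s t u x : s <= t -> x \in outs a s u -> x \in outs a t u.
Proof.
move=> st /mem_outs[p [pa hp rp]]; apply/mem_outs; exists p.
by rewrite /halted /result (halted_stable st hp).
Qed.

Lemma computes_outs p u x : computes U p u x ->
  exists s, x \in outs (size p) s u.
Proof.
by move=> /computes_halted[s hp rp]; exists s; apply/mem_outs; exists p.
Qed.

Lemma c_outs X `{Enc X} (a s : X -> nat) (u : X -> bits) :
  computable a -> computable s -> computable u ->
  computable (fun x => outs (a x) (s x) (u x)).
Proof.
move=> Ha Hs Hu; rewrite /outs /progs; comp.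
- by apply: c_halted; comp; [apply: (c_comp Hs) | apply: (c_comp Hu)]; comp.
by apply: c_result; comp; [apply: (c_comp Hs) | apply: (c_comp Hu)]; comp.
Qed.
End Outputs.

(** * Enumerations read off the code of a protocol *)

Definition rects_of (v : bits) : seq (seq bits) :=
  [seq unlist A | A <- unlist (unpair1 v)].

Definition indices_of (v : bits) : seq bits :=
  [seq unpair2 e | e <- unlist (unpair2 v)].

Lemma rects_ofE n1 n2 (P : protocol n1 n2) : rects_of (protocol_code P) =
  [seq [seq cell_code z | z <- enum A] | A : {set cell n1 n2} <- enum (rects P)].
Proof.
rewrite /rects_of pair_codeK1 list_codeK -map_comp; apply: eq_map => A /=.
exact: list_codeK.
Qed.

Lemma indices_ofE n1 n2 (P : protocol n1 n2) : indices_of (protocol_code P) =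
  [seq rect_index_code P (sel P z) | z <- enum {: cell n1 n2}].
Proof.
rewrite /indices_of pair_codeK2 list_codeK -map_comp; apply: eq_map => z /=.
exact: pair_codeK2.
Qed.

Lemma c_rects_of X `{Enc X} (v : X -> bits) :
  computable v -> computable (fun x => rects_of (v x)).
Proof.
move=> Hv; rewrite /rects_of; comp; last by apply: c_unlist; apply: c_unpair1.
by apply: c_unlist; comp.
Qed.

Lemma c_indices_of X `{Enc X} (v : X -> bits) :
  computable v -> computable (fun x => indices_of (v x)).
Proof.
move=> Hv; rewrite /indices_of; comp; last by apply: c_unlist; apply: c_unpair2.
by apply: c_unpair2; comp.
Qed.

Section Generators.
Variable U : TM.

(* The condition is [(t, P)] with [t] the index of a rectangle; [pr] selects a
   side. *)
Definition side_gen (pr : bits -> bits) (x : seq nat * bits) (s : nat) : seq bits :=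
  [seq v <- [seq pr z | z <- nth [::] (rects_of (unpair2 x.2)) (bits_nat (unpair1 x.2))]
   | v \in outs U (nth 0 x.1 0) s (unpair2 x.2)].

(** The parameters [x.1] are [[:: a; b; i; r]]. Thickness is decided from the protocol; only the two
    memberships depend on the stage [s], and they can only become true as it grows. *)
Definition thin_cell (x : seq nat * bits) (s : nat) (z : bits) : bool :=
  (unpair1 z \in outs U (nth 0 x.1 0) s x.2) &&
  ((unpair2 z \in outs U (nth 0 x.1 1) s x.2) &&
   (count (fun A : seq bits => z \in A) (rects_of x.2) <= 2 ^ nth 0 x.1 3)).

Definition rect_gen (x : seq nat * bits) (s : nat) : seq bits :=
  [seq w <- indices_of x.2 | 2 ^ nth 0 x.1 2 <=
     count (thin_cell x s) (nth [::] (rects_of x.2) (bits_nat w))].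

Lemma c_side_gen pr : computable pr -> computable (fun y => side_gen pr y.1 y.2).
Proof.
move=> Hpr; rewrite /side_gen; comp.
- by apply: c_outs; comp; apply: c_unpair2; comp.
- by apply: (c_comp Hpr); comp.
- by apply: c_rects_of; apply: c_unpair2; comp.
by apply: c_bits_nat; apply: c_unpair1; comp.
Qed.

Lemma c_rect_gen : computable (fun y => rect_gen y.1 y.2).
Proof.
rewrite /rect_gen /thin_cell; comp.
- by apply: c_unpair1; comp.
- by apply: c_outs; comp.
- by apply: c_unpair2; comp.
- by apply: c_outs; comp.
- by apply: c_rects_of; comp.
- by apply: c_rects_of; comp.
- by apply: c_bits_nat; comp.
by apply: c_indices_of; comp.
Qed.
End Generators.

(** * Counting rectangles *)

Lemma count_enum (T : finType) (A : {set T}) (p : pred T) :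
  count p (enum A) = #|[set z in A | p z]|.
Proof.
rewrite -size_filter cardE; congr size; rewrite /enum_mem -filter_predI.
by apply: eq_filter => z; rewrite !inE andbC.
Qed.

Lemma size_le_card (T : finType) (F : eqType) (f : T -> F) (A : {set T}) (l : seq F) :
  uniq l -> (forall v, v \in l -> exists2 z, z \in A & v = f z) -> size l <= #|A|.
Proof.
move=> ul lA; rewrite cardE -(size_map f); apply: uniq_leq_size => // v /lA[z zA ->].
by apply: map_f; rewrite mem_enum.
Qed.

Lemma cell_code_inj n1 n2 : injective (@cell_code n1 n2).
Proof.
move=> [x y] [x' y'] E; congr pair; apply: val_inj.
  by rewrite /= -[tval x](pair_codeK1 _ y) -/(cell_code (x, y)) E pair_codeK1.
by rewrite /= -[tval y](pair_codeK2 x) -/(cell_code (x, y)) E pair_codeK2.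
Qed.

Section Counting.
Variable U : TM.

Definition short n a u : {set n.-tuple bool} :=
  [set x | `[< exists s, tval x \in outs U a s u >]].

(** There are finitely many words of length [n], so from some stage on the enumeration is complete.
    That stage is not computable, but only its existence is used. *)
Lemma short_stage n a u : exists s, forall t, s <= t ->
  forall x : n.-tuple bool, (x \in short n a u) = (tval x \in outs U a t u).
Proof.
have /choice[f Hf] : forall x : n.-tuple bool, exists s,
    x \in short n a u -> tval x \in outs U a s u.
  move=> x; case: (boolP (x \in short n a u)) => [|_]; last by exists 0.
  by rewrite inE => /asboolP[s xs]; exists s.
exists (\max_x f x) => t ft x; apply/idP/idP => [/Hf|xt].
  by apply: outs_mono; apply: leq_trans ft; apply: leq_bigmax.
by rewrite inE; apply/asboolP; exists t.
Qed.

Lemma card_short n a u : #|short n a u| <= 2 ^ a.+1.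
Proof.
have [s Hs] := short_stage n a u; apply: leq_trans (size_outs U a s u).
rewrite cardE -(size_map val); apply: uniq_leq_size.
  by rewrite map_inj_uniq ?enum_uniq //; apply: val_inj.
by move=> _ /mapP[x + ->]; rewrite mem_enum (Hs s).
Qed.

Lemma mem_short n a u p (x : n.-tuple bool) :
  size p = a -> computes U p u x -> x \in short n a u.
Proof. by move=> <- /computes_outs[s xs]; rewrite inE; apply/asboolP; exists s. Qed.

Section Protocol.
Variables (n1 n2 : nat) (P : protocol n1 n2).
Implicit Types (A : {set cell n1 n2}) (z : cell n1 n2).
Local Notation u := (protocol_code P).

Lemma nth_rects_of A : A \in rects P ->
  nth [::] (rects_of u) (bits_nat (rect_index_code P A)) =
  [seq cell_code z | z <- enum A].
Proof.
move=> AP; rewrite nat_codeK rects_ofE (nth_map A) ?nth_index ?mem_enum //.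
by rewrite index_mem mem_enum.
Qed.

Lemma count_rects_of z :
  count (fun B : seq bits => cell_code z \in B) (rects_of u) = cell_thickness P z.
Proof.
rewrite rects_ofE count_map /cell_thickness -count_enum; apply: eq_count => A /=.
by rewrite (mem_map (@cell_code_inj n1 n2)) mem_enum.
Qed.

(** The thickness bound is a power of two so that its exponent alone has to be communicated. *)
Definition thin (a b r : nat) : {set cell n1 n2} :=
  [set z | [&& z.1 \in short n1 a u, z.2 \in short n2 b u & cell_thickness P z <= 2 ^ r]].

Definition heavy (a b i r : nat) : {set {set cell n1 n2}} :=
  [set A in rects P | 2 ^ i <= #|A :&: thin a b r|].

(* Double counting of the incidences between heavy rectangles and thin cells. *)
Lemma card_heavy a b i r : #|heavy a b i r| * 2 ^ i <= 2 ^ (r + a.+1 + b.+1).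
Proof.
apply: (@leq_trans (\sum_(A in rects P) #|A :&: thin a b r|)).
  rewrite -sum_nat_const [leqRHS](big_setID (heavy a b i r)) /=.
  apply: leq_trans (leq_addr _ _).
  rewrite [leqRHS](eq_bigl (mem (heavy a b i r))); last first.
    by move=> A; rewrite !inE; case: (A \in rects P).
  by apply: leq_sum => A; rewrite inE => /andP[].
apply: (@leq_trans (\sum_(z in thin a b r) cell_thickness P z)).
  have cardI (T : finType) (B C : {set T}) : #|B :&: C| = \sum_(z in C) (z \in B).
    rewrite -sum1_card big_mkcond [RHS]big_mkcond; apply: eq_bigr => z _ /=.
    by rewrite inE; case: (z \in B); case: (z \in C).
  under eq_bigr do rewrite cardI.
  rewrite exchange_big /=; apply: leq_sum => z _.
  rewrite /cell_thickness -count_enum -sum1_count [leqRHS]big_mkcond /= big_enum /=.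
  by apply: leq_sum => A _; case: (z \in A).
apply: (@leq_trans (#|thin a b r| * 2 ^ r)).
  by rewrite -sum_nat_const; apply: leq_sum => z; rewrite inE => /and3P[].
rewrite mulnC -addnA expnD leq_mul2l; apply/orP; right.
apply: (@leq_trans (#|short n1 a u| * #|short n2 b u|)); last first.
  by rewrite expnD leq_mul ?card_short.
rewrite -cardsX; apply: subset_leq_card; apply/subsetP => -[x y].
by rewrite !inE /= => /and3P[-> ->].
Qed.
End Protocol.
End Counting.

(** * The complexity inequality for protocols *)

Arguments pair_code : simpl never.
Arguments nat_code : simpl never.

(** For use when the enumerated word is itself the string to describe: its position followed by this
    fixed program suffices. *)
Lemma projection_program U : universal U ->
  exists q, forall v w, computes U q (pair_code v w) v.
Proof.
move=> hU; have [f Hf] : computable (fun pu : bits * bits => unpair1 pu.2).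
  by apply: c_unpair1; comp.
have [c Hc] := hU (code_machine f); have [q [_ Hq]] := Hc [::].
exists q => v w; apply/Hq/computes_code.
by have := Hf ([::], pair_code v w); rewrite /= pair_codeK1.
Qed.

Lemma complexity_side U (pr : bits -> bits) : universal U -> computable pr ->
  exists c, forall n1 n2 (P : protocol n1 n2) n (f : cell n1 n2 -> n.-tuple bool)
    (S : {set n.-tuple bool}) (z : cell n1 n2),
  (forall z', pr (cell_code z') = f z') -> (forall z', z' \in sel P z -> f z' \in S) ->
  let u := protocol_code P in let a := complexity U (f z) u in
  let N := #|S :&: short U n a u| in
  complexity U (f z) (pair_code (rect_index_code P (sel P z)) u) <=
    up_log 2 N + (size (params_code [:: up_log 2 N; a])).*2 + c.
Proof.
move=> hU Hpr; have [q Hq] := projection_program hU.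
have [c Hc] := complexity_enumerate hU (c_side_gen U Hpr).
exists (size q + c) => n1 n2 P n f S z prf fS; cbv zeta.
set u := protocol_code P; set a := complexity U (f z) u; set N := #|_|.
set w := rect_index_code P (sel P z).
have gen v s : (v \in side_gen U pr ([:: a], pair_code w u) s) =
    (v \in outs U a s u) && (v \in [seq tval (f z') | z' <- enum (sel P z)]).
  rewrite /side_gen mem_filter /= pair_codeK1 pair_codeK2.
  rewrite nth_rects_of ?sel_rects // -map_comp.
  by congr (_ && (_ \in _)); apply: eq_map => z' /=.
have [p0 Up0] := describable (f z) u hU.
have [p sp Up] := complexityP Up0.
have [s fs] := computes_outs Up; rewrite sp -/a in fs.
have := Hc [:: a] (pair_code w u) (f z) s N q (f z) _ _ (Hq _ _).
have -> : size q + up_log 2 N + (size (params_code [:: up_log 2 N; a])).*2 + c =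
  up_log 2 N + (size (params_code [:: up_log 2 N; a])).*2 + (size q + c) by lia.
apply.
  by rewrite gen fs; apply: map_f; rewrite mem_enum sel_mem.
(* Every generated word is a coordinate of a cell of the rectangle and is output at some stage, so
   it lies in [S :&: short U n a u]. *)
move=> l ul lG; apply: (@size_le_card _ _ val) => // v /lG[t].
rewrite gen => /andP[vo /mapP[z' z't E]]; exists (f z') => //.
rewrite mem_enum in z't; rewrite in_setI fS // inE; apply/asboolP; exists t.
by rewrite -E.
Qed.

Section Rectangles.
Variables (U : TM) (n1 n2 : nat) (P : protocol n1 n2) (a b i r : nat).
Local Notation u := (protocol_code P).
Local Notation x := ([:: a; b; i; r], u).

Lemma thin_cell_thin s z : thin_cell U x s (cell_code z) -> z \in thin U P a b r.
Proof.
rewrite /thin_cell /= pair_codeK1 pair_codeK2 count_rects_of => /and3P[z1 z2 zr].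
by rewrite !inE zr andbT; apply/andP; split; apply/asboolP; exists s.
Qed.

Lemma thin_stage : exists s, forall z,
  thin_cell U x s (cell_code z) = (z \in thin U P a b r).
Proof.
have [s1 H1] := short_stage U n1 a u; have [s2 H2] := short_stage U n2 b u.
exists (maxn s1 s2) => z.
rewrite /thin_cell /= pair_codeK1 pair_codeK2 count_rects_of inE.
by rewrite -(H1 _ (leq_maxl _ _)) -(H2 _ (leq_maxr _ _)).
Qed.

Lemma mem_rect_gen w s : w \in rect_gen U x s ->
  exists2 A, A \in heavy U P a b i r & w = rect_index_code P A.
Proof.
rewrite mem_filter indices_ofE => /andP[/[swap] /mapP[z _ ->]].
rewrite nth_rects_of ?sel_rects // count_map count_enum => /leq_trans Hi.
exists (sel P z) => //; rewrite inE sel_rects; apply: Hi.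
apply: subset_leq_card; apply/subsetP => z'; rewrite inE => /andP[z't].
by move=> /thin_cell_thin z'T; rewrite inE z't.
Qed.

Lemma rect_gen_sel z : 2 ^ i <= #|sel P z :&: thin U P a b r| ->
  exists s, rect_index_code P (sel P z) \in rect_gen U x s.
Proof.
move=> Hi; have [s Hs] := thin_stage; exists s.
rewrite mem_filter indices_ofE; apply/andP; split; last first.
  by apply/mapP; exists z; rewrite ?mem_enum.
rewrite nth_rects_of ?sel_rects // count_map count_enum.
apply: (leq_trans Hi); apply: subset_leq_card; apply/subsetP => z'.
by rewrite in_setI => /andP[z't z'T]; rewrite inE z't /= Hs.
Qed.
End Rectangles.

(** A shortest program for [v] given [(t, P)] is preceded by the position of [t] among the heavy
    rectangles, of which there are at most [2 ^ e]. The bound on [i] makes the truncated subtraction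
    in [e] exact. *)
Lemma complexity_rect U : universal U ->
  exists c, forall n1 n2 (P : protocol n1 n2) z v a b i r,
  2 ^ i <= #|sel P z :&: thin U P a b r| -> i <= r + a.+1 + b.+1 ->
  let u := protocol_code P in let e := r + a.+1 + b.+1 - i in
  complexity U v u <=
    complexity U v (pair_code (rect_index_code P (sel P z)) u) + e +
    (size (params_code [:: e; a; b; i; r])).*2 + c.
Proof.
move=> hU; have [c Hc] := complexity_enumerate hU (c_rect_gen U).
exists c => n1 n2 P z v a b i r Hi ile; cbv zeta.
set u := protocol_code P; set e := _ - i.
have [s ws] := rect_gen_sel Hi.
set w := rect_index_code _ _ in ws *.
have [p0 Up0] := describable v (pair_code w u) hU.
have [p sp Up] := complexityP Up0.
have := Hc [:: a; b; i; r] u w s (2 ^ e) p v ws _ Up.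
rewrite up_expnK // sp; apply=> l ul lG.
apply: (@leq_trans #|heavy U P a b i r|).
  by apply: (size_le_card (f := rect_index_code P)) => // w' /lG[t /mem_rect_gen].
by rewrite -(leq_pmul2r (expn_gt0 2 i)) -expnD subnK // card_heavy.
Qed.

Lemma size_params_code B ps : all (fun m => m < B) ps ->
  size (params_code ps) <= size ps * ((up_log 2 B).*2 + 1).
Proof.
elim: ps => //= m ps IH /andP[mB /IH].
rewrite /params_code /= size_pair_code; have := size_nat_code_lt mB; lia.
Qed.

Lemma up_log2_le m k : m <= 2 ^ k -> up_log 2 m <= k.
Proof. exact: up_log_min. Qed.

Lemma up_log2M m n : up_log 2 (m * n) <= up_log 2 m + up_log 2 n.
Proof. by apply: up_log2_le; rewrite expnD leq_mul ?up_logP. Qed.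

Lemma up_log2_trunc m : up_log 2 m <= (trunc_log 2 m).+1.
Proof. by apply: up_log2_le; rewrite ltnW // trunc_log_ltn. Qed.

(** The subtracted terms are moved across, which leaves an inequality in [nat], and logarithms are
    rounded up. *)
Lemma complexity_protocol U : universal U ->
  exists c, forall n1 n2 (P : protocol n1 n2) (x : n1.-tuple bool) (y : n2.-tuple bool),
  let u := protocol_code P in let t := sel P (x, y) in
  let v := pair_code (rect_index_code P t) u in
  complexity U (pair_code x y) u + complexity U x v + complexity U y v <=
  complexity U x u + complexity U y u + complexity U (pair_code x y) v
    + up_log 2 (thickness P t) + c * (up_log 2 (maxn n1 n2).+1 + 1).
Proof.
move=> hU.
have [c0 H0] : exists c, forall p u, complexity U p u <= size p + c.
  have Hf : computable (fun pu : bits * bits => pu.1) by comp.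
  exact: (complexity_total hU Hf).
have [c1 H1] := complexity_side hU (c_unpair1 c_id).
have [c2 H2] := complexity_side hU (c_unpair2 c_id).
have [c3 H3] := complexity_rect hU.
(* The product [(2 * c0 + 11) * n.+1] will exceed every parameter; the largest possible one is [e],
   at most [7 * n + 2 * c0 + 7]. Two lists of 2 parameters and one of 5 are used, each entry costs
   twice its length plus one, and lists are doubled again: [2 * 2 * (2 + 2 + 5) = 36]. *)
pose k := up_log 2 (2 * c0 + 11).
pose C := 36 * k + 100 + 3 * c0 + c1 + c2 + c3; exists C => n1 n2 P x y; cbv zeta.
set u := protocol_code P; set t := sel P (x, y); set v := pair_code _ u.
set n := maxn n1 n2; set r := up_log 2 (thickness P t).
have n1n : n1 <= n := leq_maxl _ _; have n2n : n2 <= n := leq_maxr _ _.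
set a := complexity U x u; set b := complexity U y u.
have := H0 (pair_code x y) u; have := H0 x v; have := H0 y v.
have := H0 x u; have := H0 y u.
rewrite -/a -/b size_pair_code !size_tuple => b_le a_le yv_le xv_le xy_le.
set lg := up_log 2 n.+1.
have CL : 36 * lg + C <= C * (lg + 1).
  by rewrite mulnDr muln1 leq_add2r leq_mul2r /C; apply/orP; right; lia.
(* The left-hand side is at most [5 * n + 1 + 3 * c0] by the trivial bounds, so a large [r] settles
   the matter. Otherwise [r] is linear in [n] and can be a parameter. *)
case: (leqP r (5 * n + 5)) => [r_le|r_gt]; last by rewrite /C in CL *; lia.
have [S [T tST]] := rectsP (sel_rects P (x, y)).
pose NX := #|S :&: short U n1 a u|; pose NY := #|T :&: short U n2 b u|.
have K1 : complexity U x v <=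
    up_log 2 NX + (size (params_code [:: up_log 2 NX; a])).*2 + c1.
  apply: (H1 n1 n2 P n1 fst S (x, y)) => [z|z]; first exact: pair_codeK1.
  by rewrite tST inE => /andP[].
have K2 : complexity U y v <=
    up_log 2 NY + (size (params_code [:: up_log 2 NY; b])).*2 + c2.
  apply: (H2 n1 n2 P n2 snd T (x, y)) => [z|z]; first exact: pair_codeK2.
  by rewrite tST inE => /andP[].
have xX : x \in short U n1 a u.
  by have [p0 /complexityP[p sp]] := describable x u hU; apply: mem_short.
have yY : y \in short U n2 b u.
  by have [p0 /complexityP[p sp]] := describable y u hU; apply: mem_short.
have /setXP[xS yT] : (x, y) \in setX S T by rewrite -tST sel_mem.
have NX0 : 0 < NX by apply/card_gt0P; exists x; rewrite inE xS.
have NY0 : 0 < NY by apply/card_gt0P; exists y; rewrite inE yT.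
(* [NX * NY] counts the cells of [t] in [X x Y]. Rounding down makes [t] heavy, at a loss of at most
   2 against the two logarithms rounded up. *)
pose i := trunc_log 2 (NX * NY).
have iN : 2 ^ i <= NX * NY by apply: trunc_logP => //; rewrite muln_gt0 NX0.
have NX_le : NX <= 2 ^ n1.
  by apply: leq_trans (max_card _) _; rewrite card_tuple card_bool.
have NY_le : NY <= 2 ^ n2.
  by apply: leq_trans (max_card _) _; rewrite card_tuple card_bool.
have lX := up_log2_le NX_le; have lY := up_log2_le NY_le.
have lXY : up_log 2 NX + up_log 2 NY <= i + 2.
  have : trunc_log 2 NX + trunc_log 2 NY <= i.
    apply: trunc_log_max => //; rewrite expnD leq_mul //; exact: trunc_logP.
  have := up_log2_trunc NX; have := up_log2_trunc NY; lia.
have i_le : i <= n1 + n2.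
  by rewrite -(@leq_exp2l 2) // expnD (leq_trans iN) // leq_mul.
have i_le2 : i <= r + a.+1 + b.+1.
  rewrite -(@leq_exp2l 2) //; apply: (leq_trans iN); rewrite -addnA expnD.
  apply: leq_trans (leq_pmull _ (expn_gt0 2 r)); rewrite expnD leq_mul //.
    by apply: leq_trans (card_short U n1 a u); apply/subset_leq_card/subsetIr.
  by apply: leq_trans (card_short U n2 b u); apply/subset_leq_card/subsetIr.
(* All of [(S :&: X) x (T :&: Y)] lies in [t], so its cells have thickness at most that of [t],
   hence at most [2 ^ r]. *)
have Hthin : 2 ^ i <= #|sel P (x, y) :&: thin U P a b r|.
  apply: (leq_trans iN); rewrite -cardsX; apply: subset_leq_card.
  apply/subsetP => -[x' y']; rewrite inE => /andP[]; rewrite !inE.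
  move=> /andP[x'S x'X] /andP[y'T y'Y].
  have zt : (x', y') \in t by rewrite /t tST inE /= x'S.
  rewrite zt /= x'X y'Y /=; apply: leq_trans (up_logP _ _) => //.
  exact: (leq_bigmax_cond (F := cell_thickness P)).
have K3 : complexity U (pair_code x y) u <=
    complexity U (pair_code x y) v + (r + a.+1 + b.+1 - i) +
    (size (params_code [:: r + a.+1 + b.+1 - i; a; b; i; r])).*2 + c3.
  exact: H3.
pose B := (2 * c0 + 11) * n.+1.
have BK : up_log 2 B <= k + lg := up_log2M _ _.
have B_ge : 11 * n + 2 * c0 + 11 <= B.
  by rewrite /B mulnS mulnDl; move: (2 * c0 * n) => d; clear; lia.
have SX : size (params_code [:: up_log 2 NX; a]) <= 2 * ((up_log 2 B).*2 + 1).
  by apply: size_params_code => /=; rewrite andbT; apply/andP; split; lia.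
have SY : size (params_code [:: up_log 2 NY; b]) <= 2 * ((up_log 2 B).*2 + 1).
  by apply: size_params_code => /=; rewrite andbT; apply/andP; split; lia.
have SR : size (params_code [:: r + a.+1 + b.+1 - i; a; b; i; r])
    <= 5 * ((up_log 2 B).*2 + 1).
  by apply: size_params_code => /=; rewrite andbT; apply/and5P; split; lia.
rewrite /C in CL *; lia.
Qed.

(** * Passage to real logarithms *)

Import Order.TTheory GRing.Theory Num.Theory.
Local Open Scope ring_scope.

Lemma trunc_log_le_log2 (R : realType) (m : nat) :
  (trunc_log 2 m)%:R <= log2 (m%:R : R).
Proof.
have ln2 : 0 < ln (2 : R) by rewrite ln_gt0 // ltr1n.
(* At 0 both logarithms take the default value 0. *)
case: m => [|m]; first by rewrite trunc_log0 /log2 ln0 // mul0r.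
rewrite /log2 ler_pdivlMr // mulr_natl -lnXn //.
rewrite ler_ln ?posrE ?exprn_gt0 ?ltr0n //.
by rewrite -natrX ler_nat; apply: trunc_logP.
Qed.

Lemma up_log_le_log2 (R : realType) (m : nat) :
  (up_log 2 m)%:R <= log2 (m%:R : R) + 1.
Proof.
apply: (@le_trans _ _ ((trunc_log 2 m)%:R + 1)); last first.
  by rewrite lerD2r trunc_log_le_log2.
by rewrite natr1 ler_nat up_log2_trunc.
Qed.

Lemma up_logS_le_log2 (R : realType) (m : nat) :
  (up_log 2 m.+1)%:R <= log2 (m%:R : R) + 1.
Proof.
apply: (@le_trans _ _ ((trunc_log 2 m)%:R + 1)); last first.
  by rewrite lerD2r trunc_log_le_log2.
by rewrite natr1 ler_nat; apply: up_log2_le; apply: trunc_log_ltn.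
Qed.

Lemma log2_nat_ge0 (R : realType) (m : nat) : 0 <= log2 (m%:R : R).
Proof. by apply: le_trans (trunc_log_le_log2 R m). Qed.

Theorem theorem3p1 (R : realType) (U : TM) (hU : universal U) :
  exists c : R, forall (n1 n2 : nat) (P : protocol n1 n2)
      (x : n1.-tuple bool) (y : n2.-tuple bool),
    let n := maxn n1 n2 in
    let txy := sel P (x, y) in
    (mutual_info U x y (protocol_code P))%:~R >=
      (mutual_info U x y
         (pair_code (rect_index_code P txy) (protocol_code P)))%:~R
      - log2 (thickness P txy)%:R
      - c * (log2 n%:R + 1) :> R.
Proof.
(* Rounding [log2 n] up gives [c * (log2 n + 2)], and rounding the logarithm of the thickness adds
   1; [(2 * c + 1) * (log2 n + 1)] covers both, even when [log2 n] is 0. *)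
have [c Hc] := complexity_protocol hU; exists (2 * c%:R + 1) => n1 n2 P x y; cbv zeta.
move: (Hc n1 n2 P x y); cbv zeta; rewrite /mutual_info.
set v := pair_code _ _; set n := maxn n1 n2; set rho := thickness _ _.
rewrite -(ler_nat R) !natrD natrM natrD => H.
have := up_log_le_log2 R rho; have := up_logS_le_log2 R n.
have n0 := log2_nat_ge0 R n.
rewrite !rmorphB !rmorphD /= => Hn Hr.
have : c%:R * ((up_log 2 n.+1)%:R + 1) <= c%:R * (log2 n%:R + 1 + 1) :> R.
  by rewrite ler_wpM2l // lerD2r.
have : 0 <= c%:R * log2 n%:R :> R by rewrite mulr_ge0.
lra.
Qed.
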